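(* Consider a vehicle moving in a two-dimensional scene, modelled by $\mathbb R^2$, which contains a finite set $\mathcal W$ of walls (lines in $\mathbb R^2$). Let $\mathbf m_1^{\mathrm{ini}},\mathbf m_2^{\mathrm{ini}},\mathbf m_3^{\mathrm{ini}}\in\mathbb R^2$ be the initial positions of three microphones mounted on the vehicle, and assume they do not lie on a common line. Assume that a loudspeaker is either placed at a fixed position in the scene or mounted on the vehicle. (The microphones and the loudspeaker lie in a common plane, parallel to the plane of motion, which is the plane $\mathbb R^2$ considered here.) Then, in either of the two cases, almost all vehicle positions are good: the set of vehicle positions $\phi$ for which it is not true that all walls whose echoes are heard by every microphone are detected and no ghost walls are detected is contained in a subvariety of dimension strictly less than $3$ of the three-dimensional variety of all vehicle positions.
   Context: **Vehicle positions.** The vehicle positions form the group of all maps $\phi:\mathbb R^2\to\mathbb R^2$, $\phi(v)=Av+b$ with $A\in\mathbb R^{2\times 2}$ orthogonal of determinant $1$ and $b\in\mathbb R^2$, regarded as an affine variety in $\mathbb R^6$ of dimension $3$. In the vehicle position $\phi$ the microphones are at $\mathbf m_i=\phi(\mathbf m_i^{\mathrm{ini}})$, $i=1,2,3$. The loudspeaker position is $\mathbf L$, where either $\mathbf L\in\mathbb R^2$ is constant (loudspeaker at a fixed position) or $\mathbf L=\phi(\mathbf L^{\mathrm{ini}})$ for a given $\mathbf L^{\mathrm{ini}}\in\mathbb R^2$ (loudspeaker mounted on the vehicle). **Walls and mirror points.** A wall is identified with the line in $\mathbb R^2$ containing it. The mirror point of a wall $W$ is $\mathrm{ref}_W(\mathbf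 L)$, the reflection of $\mathbf L$ at the line $W$. Walls are identified through their mirror points (a point $\mathbf s\ne\mathbf L$ is the mirror point of exactly one line). **Echoes.** Only first-order echoes are considered, ray acoustics is used, and all measurements are exact. For a vehicle position $\phi$ and $i\in\{1,2,3\}$, let $\mathcal H_i(\phi)\subseteq\mathcal W$ be the set of walls whose first-order echo is heard by microphone $i$; these sets are arbitrary. The measured data are the sets $$\mathcal D_i=\{\lVert\mathrm{ref}_W(\mathbf L)-\mathbf m_i\rVert^2 : W\in\mathcal H_i(\phi)\},\quad i=1,2,3,$$ without information on which wall a value comes from. **Wall detection algorithm.** Let $D_{i,j}=\lVert\mathbf m_i-\mathbf m_j\rVert^2$ and define $$f_D(u_1,u_2,u_3)=\det\begin{pmatrix}0&u_1&u_2&u_3&1\\ u_1&D_{1,1}&D_{1,2}&D_{1,3}&1\\ u_2&D_{2,1}&D_{2,2}&D_{2,3}&1\\ u_3&D_{3,1}&D_{3,2}&D_{3,3}&1\\ 1&1&1&1&0\end{pmatrix}.$$ For every $(d_1,d_2,d_3)\in\mathcal D_1\times\mathcal D_2\times\mathcal D_3$ with $f_D(d_1,d_2,d_3)=0$, the algorithm outputs the wall whose mirror point is the unique point $\mathbf s\in\mathbb R^2$ with $\lVert\mathbf s-\mathbf m_i\rVert^2=d_i$ for $i=1,2,3$. A wall is called detected if it is output by the algorithm. A ghost wall is a detected wall that does not exist, i.e. an output whose point $\mathbf s$ is not equal to $\mathrm{ref}_W(\mathbf L)$ for any $W\in\mathcal W$. *)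

(* Defs.v *)
From HB Require Import structures.
From mathcomp Require Import all_boot all_order all_algebra.
From mathcomp Require Import boolp classical_sets cardinality.
From mathcomp Require Import reals ereal.
From mathcomp Require Import ring lra.
(* Not imported: the notations of mpoly clash with those of mathcomp-analysis. *)
From mathcomp Require mpoly.

Set Implicit Arguments.
Unset Strict Implicit.
Unset Printing Implicit Defensive.

Import Order.TTheory GRing.Theory Num.Theory.

Local Open Scope classical_set_scope.
Local Open Scope ring_scope.

Section Zariski.
Variables (R : realType) (n : nat).
Implicit Type Y : set 'rV[R]_n.

Definition zero_locus (I : set (mpoly.mpoly n R)) : set 'rV[R]_n :=
  [set x | forall p, I p -> mpoly.meval (fun i => x 0 i) p = 0].

Definition zariski_closed Y := exists I, Y = zero_locus I.

Definition zariski_irreducible Y :=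
  Y !=set0 /\
  forall Y1 Y2, zariski_closed Y1 -> zariski_closed Y2 ->
    Y `<=` Y1 `|` Y2 -> Y `<=` Y1 \/ Y `<=` Y2.

(* X_0, ..., X_k is a strictly increasing chain of length k. *)
Definition irreducible_chain Y (k : nat) (X : nat -> set 'rV[R]_n) :=
  (forall i, (i <= k)%N ->
     [/\ zariski_closed (X i), zariski_irreducible (X i) & X i `<=` Y]) /\
  (forall i, (i < k)%N -> X i `<` X i.+1).

(* Krull dimension of a Zariski closed set; it is -oo for the empty set. *)
Definition dimension Y : \bar R :=
  ereal_sup [set (k%:R)%:E | k in [set k | exists X, irreducible_chain Y k X]].

End Zariski.

Section Plane.
Variable R : realType.
Implicit Types (W : set 'cV[R]_2) (p q v x y s : 'cV[R]_2).

(* The norm of mathcomp-analysis on matrices is the maximum norm, whence the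
   explicit Euclidean inner product. *)
Definition dot x y : R := \sum_k x k 0 * y k 0.

Definition sqdist x y : R := dot (x - y) (x - y).

Definition line p v : set 'cV[R]_2 := [set p + t *: v | t in [set: R]].

Definition is_line W := exists p v, v != 0 /\ W = line p v.

Definition is_mirror_point W x s :=
  W (2^-1 *: (x + s)) /\
  forall p q, W p -> W q -> dot (s - x) (p - q) = 0.

(* Reflection of x at the line W; see refE for the explicit formula. *)
Definition ref W x : 'cV[R]_2 := xget x [set s | is_mirror_point W x s].

Lemma refE p v x : v != 0 ->
  ref (line p v) x = 2 *: (p + (dot (x - p) v / dot v v) *: v) - x.
Proof.
move=> v0.
have dotE a b : dot a b = a 0 0 * b 0 0 + a 1 0 * b 1 0.
  rewrite /dot !big_ord_recl big_ord0 addr0.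
  by congr (_ + a _ _ * b _ _); apply/val_inj.
have colP (a b : 'cV[R]_2) : a 0 0 = b 0 0 -> a 1 0 = b 1 0 -> a = b.
  move=> h0 h1; apply/matrixP => i j; rewrite (ord1 j).
  case: i => -[|[|//]] hi; [move: h0 | move: h1];
  by congr (a _ _ = b _ _); apply/val_inj.
have vv0 : dot v v != 0.
  apply: contra v0; rewrite dotE -!expr2 paddr_eq0 ?sqr_ge0 // !sqrf_eq0.
  by move=> /andP[/eqP h0 /eqP h1]; apply/eqP/colP; rewrite ?mxE.
have mirror_uniq s : is_mirror_point (line p v) x s ->
    s = 2 *: (p + (dot (x - p) v / dot v v) *: v) - x.
  move=> [[t _ ht] /(_ (p + 1 *: v) p)].
  have -> : s = 2 *: (p + t *: v) - x.
    by rewrite ht scalerA divff ?pnatr_eq0 // scale1r [x + s]addrC addrK.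
  move=> /(_ (ex_intro2 _ _ 1 I erefl)).
  have pl : line p v p by exists 0 => //; rewrite scale0r addr0.
  move=> /(_ pl) h; suff -> : t = dot (x - p) v / dot v v by [].
  apply: (mulIf vv0); rewrite divfK //; move: h.
  by rewrite !dotE !mxE => h; lra.
apply: mirror_uniq; rewrite /ref; case: xgetP => [s -> //|].
set s := 2 *: (p + (dot (x - p) v / dot v v) *: v) - x.
move=> /(_ s) [] /=; split.
  exists (dot (x - p) v / dot v v) => //.
  by rewrite [x + s]addrC /s subrK scalerA mulVf ?pnatr_eq0 // scale1r.
move=> _ _ [a _ <-] [b _ <-].
have h : dot (x - p) v / dot v v * dot v v = dot (x - p) v by rewrite divfK.
rewrite /s; move: (_ / _) h => t; rewrite !dotE !mxE => h.
transitivity (2 * (a - b) * (t * (v 0 0 * v 0 0 + v 1 0 * v 1 0) -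
  ((x 0 0 - p 0 0) * v 0 0 + (x 1 0 - p 1 0) * v 1 0))); first by ring.
by rewrite h subrr mulr0.
Qed.

End Plane.

Section Vehicle.
Variable R : realType.

Record vehicle_position := VehiclePosition {
  rotation : 'M[R]_2;
  translation : 'cV[R]_2;
  rotation_orthogonal : rotation^T *m rotation = 1%:M;
  rotation_det : \det rotation = 1
}.

Implicit Type phi : vehicle_position.

Definition move phi (v : 'cV[R]_2) : 'cV[R]_2 :=
  rotation phi *m v + translation phi.

(* The point of R^6 given by the entries of A and b, where phi(v) = A v + b. *)
Definition coordinates phi : 'rV[R]_(2 * 2 + 2) :=
  row_mx (mxvec (rotation phi)) (translation phi)^T.

Definition vehicle_variety : set 'rV[R]_(2 * 2 + 2) := range coordinates.

Inductive loudspeaker :=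
  | Fixed of 'cV[R]_2
  | Mounted of 'cV[R]_2.

Definition loudspeaker_position (l : loudspeaker) phi : 'cV[R]_2 :=
  match l with
  | Fixed L => L
  | Mounted Lini => move phi Lini
  end.

Definition f_D (D : 'M[R]_3) (u : 'rV[R]_3) : R :=
  \det (block_mx (0 : 'M_1) (row_mx u (const_mx 1 : 'M_1))
                 (col_mx u^T (const_mx 1 : 'M_1))
                 (block_mx D (const_mx 1) (const_mx 1) (0 : 'M_1))).

Section Detection.
(* walls: the existing walls; heard i phi: the walls whose first-order echo
   microphone i hears when the vehicle position is phi. *)
Variables (walls : set (set 'cV[R]_2)).
Variables (mini : 'I_3 -> 'cV[R]_2) (l : loudspeaker).
Variables (heard : 'I_3 -> vehicle_position -> set (set 'cV[R]_2)).
Variable phi : vehicle_position.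

Let L := loudspeaker_position l phi.
Let m i := move phi (mini i).

Definition measured (i : 'I_3) : set R :=
  [set sqdist (ref W L) (m i) | W in heard i phi].

(* s is the mirror point of a wall output by the algorithm.  Walls are
   identified through their mirror points. *)
Definition output (s : 'cV[R]_2) :=
  exists d : 'rV[R]_3,
    [/\ forall i, measured i (d 0 i),
        f_D (\matrix_(i, j) sqdist (m i) (m j)) d = 0
      & unique (fun x => forall i, sqdist x (m i) = d 0 i) s].

Definition detected (W : set 'cV[R]_2) := output (ref W L).

Definition ghost (s : 'cV[R]_2) :=
  output s /\ ~ exists2 W, walls W & s = ref W L.

Definition good_position :=
  (forall W, (forall i, heard i phi W) -> detected W) /\
  (forall s, ~ ghost s).

End Detection.
End Vehicle.

(* Main.v *)
(* Microphone i hears the wall W i.  If a point s has the distances to the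
   microphones that the mirror points of W 0, W 1, W 2 have, then a polynomial in
   the vehicle position vanishes (trilateration_defect).  If it vanishes at all
   positions, its restriction to the translations with rotation angle 0 and pi is
   identically zero; comparing the leading coefficients along lines of
   translations, and using that the Gram form of the microphones is positive
   definite, one finds that the three mirror points always agree, so that s is no
   ghost.  Hence all bad positions lie in the zero set of finitely many
   polynomials, none of which vanishes on the whole variety V of positions.

   V is irreducible because any two of its points lie on a rational curve in V,
   so the union of these zero sets is a proper closed subset Y.  A chain of
   length 3 in Y extends by V to a chain of length 4.  Choosing functions f i that
   vanish on its i-th but not on its (i+1)-st member gives four functions whose
   monomials are linearly independent on V.  But V has a rational chart with three
   parameters, where the M ^ 4 monomials with exponents < M become polynomials
   of degree O(M) after clearing denominators, and these span a space of
   dimension O(M ^ 3). *)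

Require Import Defs.
From mathcomp Require Import all_boot all_order all_algebra.
From mathcomp Require Import boolp classical_sets cardinality.
From mathcomp Require Import reals ereal.
From mathcomp Require Import ring lra.
From mathcomp Require mpoly.
(* The notations of mpoly clash with those of mathcomp-analysis. *)
Import -(notations) mpoly.

Set Implicit Arguments.
Unset Strict Implicit.
Unset Printing Implicit Defensive.

Import Order.TTheory GRing.Theory Num.Theory.

Local Open Scope classical_set_scope.
Local Open Scope ring_scope.

(** * Small index types and plane coordinates *)

Lemma ord2P (i : 'I_2) : i = 0 \/ i = 1.
Proof. by case: i => -[|[|//]] hi; [left|right]; apply/val_inj. Qed.

Lemma ord3P (i : 'I_3) : [\/ i = 0, i = 1 | i = ord_max].
Proof.
by case: i => -[|[|[|//]]] hi;
  [constructor 1|constructor 2|constructor 3]; apply/val_inj.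
Qed.

Lemma sum2E (V : nmodType) (F : 'I_2 -> V) : \sum_i F i = F 0 + F 1.
Proof.
by rewrite !big_ord_recl big_ord0 addr0; congr (_ + F _); apply/val_inj.
Qed.

Lemma colP2 (R : Type) (a b : 'cV[R]_2) :
  a 0 0 = b 0 0 -> a 1 0 = b 1 0 -> a = b.
Proof.
by move=> h0 h1; apply/matrixP => i j; rewrite (ord1 j); case: (ord2P i) => ->.
Qed.

Lemma dotE (R : realType) (a b : 'cV[R]_2) :
  dot a b = a 0 0 * b 0 0 + a 1 0 * b 1 0.
Proof. by rewrite /dot sum2E. Qed.

(** * Polynomial functions *)

(** An inductive predicate gives induction and closure under operations directly; [polyfunP]
    identifies it with the evaluations of [mpoly]. *)
Inductive polyfun (R : realType) (n : nat) : ('rV[R]_n -> R) -> Prop :=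
  | polyfun_cst c : polyfun (fun _ : 'rV[R]_n => c)
  | polyfun_coord i : polyfun (fun x : 'rV[R]_n => x 0 i)
  | polyfunD f g : polyfun f -> polyfun g ->
      polyfun (fun x => f x + g x)
  | polyfunM f g : polyfun f -> polyfun g ->
      polyfun (fun x => f x * g x).
Arguments polyfun {R n} f.
Arguments polyfun_cst {R n} c.
Arguments polyfun_coord {R n} i.
Arguments polyfunD {R n f g}.
Arguments polyfunM {R n f g}.

Section PolynomialFunctions.
Context {R : realType} {n : nat}.
Implicit Types f g : 'rV[R]_n -> R.

Lemma polyfunN f : polyfun f -> polyfun (fun x => - f x).
Proof.
move=> hf; have := polyfunM (polyfun_cst (-1)) hf.
by congr polyfun; apply/funext => x; rewrite mulN1r.
Qed.

Lemma polyfunB f g : polyfun f -> polyfun g -> polyfun (fun x => f x - g x).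
Proof. by move=> hf hg; apply: polyfunD => //; apply: polyfunN. Qed.

Lemma polyfunX f k : polyfun f -> polyfun (fun x => f x ^+ k).
Proof.
move=> hf; elim: k => [|k IH]; first exact: polyfun_cst.
have := polyfunM hf IH.
by congr polyfun; apply/funext => x; rewrite exprS.
Qed.

Lemma polyfun_sum (I : Type) (s : seq I) (P : pred I)
    (F : I -> 'rV[R]_n -> R) :
  (forall i, polyfun (F i)) -> polyfun (fun x => \sum_(i <- s | P i) F i x).
Proof.
move=> hF; elim: s => [|i s IH].
  have := @polyfun_cst R n 0.
  by congr polyfun; apply/funext => x; rewrite big_nil.
have [Pi|Pi] := boolP (P i); last first.
  by move: IH; congr polyfun; apply/funext => x; rewrite big_cons (negbTE Pi).
have := polyfunD (hF i) IH.
by congr polyfun; apply/funext => x; rewrite big_cons Pi.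
Qed.

Lemma polyfun_prod (I : Type) (s : seq I) (P : pred I)
    (F : I -> 'rV[R]_n -> R) :
  (forall i, polyfun (F i)) -> polyfun (fun x => \prod_(i <- s | P i) F i x).
Proof.
move=> hF; elim: s => [|i s IH].
  have := @polyfun_cst R n 1.
  by congr polyfun; apply/funext => x; rewrite big_nil.
have [Pi|Pi] := boolP (P i); last first.
  by move: IH; congr polyfun; apply/funext => x; rewrite big_cons (negbTE Pi).
have := polyfunM (hF i) IH.
by congr polyfun; apply/funext => x; rewrite big_cons Pi.
Qed.

Lemma polyfunP f :
  polyfun f <-> exists p : mpoly n R, f = fun x => meval (fun i => x 0 i) p.
Proof.
split.
- elim=> [c|i|{}f g _ [p ->] _ [q ->]|{}f g _ [p ->] _ [q ->]].
  + by exists (mpolyC n c); apply/funext => x; rewrite mevalC.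
  + by exists (mpolyX R (mnm1 i)); apply/funext => x; rewrite mevalXU.
  + by exists (p + q); apply/funext => x; rewrite mevalD.
  + by exists (p * q); apply/funext => x; rewrite mevalM.
- case=> p ->; under eq_fun do rewrite mevalE.
  apply: polyfun_sum => m; apply: polyfunM; first exact: polyfun_cst.
  by apply: polyfun_prod => i; apply/polyfunX/polyfun_coord.
Qed.

Lemma zariski_closed_zeros (G : set ('rV[R]_n -> R)) :
  (forall g, G g -> polyfun g) ->
  zariski_closed [set x | forall g, G g -> g x = 0].
Proof.
move=> hG; exists [set p | G (fun x => meval (fun i => x 0 i) p)].
apply/seteqP; split => x /= h.
- by move=> p /h.
- by move=> g Gg; have /polyfunP[p gE] := hG _ Gg; rewrite gE; apply: h;
  rewrite /= -gE.
Qed.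

Lemma zariski_closed_zero f : polyfun f -> zariski_closed [set x | f x = 0].
Proof.
move=> hf.
have := @zariski_closed_zeros [set f]; rewrite (_ : mkset _ = [set x | f x = 0]).
  by apply=> g ->.
by apply/seteqP; split => x /= h; [exact: h | move=> g ->].
Qed.

Lemma zariski_closedI (A B : set 'rV[R]_n) :
  zariski_closed A -> zariski_closed B -> zariski_closed (A `&` B).
Proof.
move=> [I ->] [J ->]; exists (I `|` J); apply/seteqP; split => x /=.
- by move=> [hI hJ] p [/hI|/hJ].
- by move=> h; split => p hp; apply: h; [left|right].
Qed.

(* The coordinate ring of an irreducible closed set is an integral domain. *)
Lemma irreducible_polyfunM (Y : set 'rV[R]_n) f g :
  zariski_irreducible Y -> polyfun f -> polyfun g ->
  (forall x, Y x -> f x * g x = 0) -> (exists2 x, Y x & f x != 0) ->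
  forall x, Y x -> g x = 0.
Proof.
move=> [_ irr] hf hg fg0 [x0 Yx0 fx0] x Yx.
have [|h|h] := irr _ _ (zariski_closed_zero hf) (zariski_closed_zero hg).
- move=> y /fg0/eqP; rewrite mulf_eq0 => /orP[]/eqP; by [left|right].
- by move: fx0; rewrite (h _ Yx0) eqxx.
- exact: h.
Qed.

Lemma zariski_closed_separate (A : set 'rV[R]_n) x :
  zariski_closed A -> ~ A x ->
  exists f, [/\ polyfun f, forall y, A y -> f y = 0 & f x != 0].
Proof.
move=> [I ->] /existsNP[p] /not_implyP[Ip px].
exists (fun x => meval (fun i => x 0 i) p); split.
- by apply/polyfunP; exists p.
- by move=> y; apply.
- exact/eqP.
Qed.

Definition polymx (k l : nat) (F : 'rV[R]_n -> 'M[R]_(k, l)) :=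
  forall i j, polyfun (fun x => F x i j).

Lemma polymx_cst k l (A : 'M[R]_(k, l)) : polymx (fun=> A).
Proof. by move=> i j; exact: polyfun_cst. Qed.

Lemma polymxD k l (F G : 'rV[R]_n -> 'M[R]_(k, l)) : polymx F -> polymx G ->
  polymx (fun x => F x + G x).
Proof.
by move=> hF hG i j; have := polyfunD (hF i j) (hG i j);
  congr polyfun; apply/funext => x; rewrite mxE.
Qed.

Lemma polymxZ k l f (F : 'rV[R]_n -> 'M[R]_(k, l)) : polyfun f -> polymx F ->
  polymx (fun x => f x *: F x).
Proof.
by move=> hf hF i j; have := polyfunM hf (hF i j);
  congr polyfun; apply/funext => x; rewrite mxE.
Qed.

Lemma polymxB k l (F G : 'rV[R]_n -> 'M[R]_(k, l)) : polymx F -> polymx G ->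
  polymx (fun x => F x - G x).
Proof.
move=> hF hG i j; have := polyfunB (hF i j) (hG i j).
by congr polyfun; apply/funext => x; rewrite !mxE.
Qed.

Lemma polymxM k l m (F : 'rV[R]_n -> 'M[R]_(k, l))
    (G : 'rV[R]_n -> 'M[R]_(l, m)) : polymx F -> polymx G ->
  polymx (fun x => F x *m G x).
Proof.
move=> hF hG i j.
have : polyfun (fun x => \sum_s F x i s * G x s j).
  by apply: polyfun_sum => s; apply: polyfunM.
by congr polyfun; apply/funext => x; rewrite mxE.
Qed.

Lemma polymx_tr k l (F : 'rV[R]_n -> 'M[R]_(k, l)) : polymx F ->
  polymx (fun x => (F x)^T).
Proof.
by move=> hF i j; move: (hF j i); congr polyfun; apply/funext => x; rewrite mxE.
Qed.

Lemma polyfun_det k (F : 'rV[R]_n -> 'M[R]_k) : polymx F ->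
  polyfun (fun x => \det (F x)).
Proof.
move=> hF; apply: polyfun_sum => s; apply: polyfunM; first exact: polyfun_cst.
by apply: polyfun_prod => i; exact: hF.
Qed.

Lemma polyfun_dot (F G : 'rV[R]_n -> 'cV[R]_2) : polymx F -> polymx G ->
  polyfun (fun x => dot (F x) (G x)).
Proof. by move=> hF hG; apply: polyfun_sum => i; apply: polyfunM. Qed.

Lemma polyfun_sqdist (F G : 'rV[R]_n -> 'cV[R]_2) : polymx F -> polymx G ->
  polyfun (fun x => sqdist (F x) (G x)).
Proof. by move=> hF hG; apply: polyfun_dot; apply: polymxB. Qed.

End PolynomialFunctions.
(** * The variety of vehicle positions *)

Lemma det_mx2 (R : comPzRingType) (A : 'M[R]_2) :
  \det A = A 0 0 * A 1 1 - A 0 1 * A 1 0.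
Proof.
rewrite (expand_det_row _ 0) sum2E /cofactor !det_mx11 !mxE /= expr0 expr1 mul1r.
rewrite mulN1r mulrN.
by congr (_ * A _ _ - A _ _ * A _ _); apply/val_inj.
Qed.

Definition linear_part (R : realType) (x : 'rV[R]_(2 * 2 + 2)) : 'M[R]_2 :=
  vec_mx (lsubmx x).

Definition translation_part (R : realType) (x : 'rV[R]_(2 * 2 + 2)) :
  'cV[R]_2 := (rsubmx x)^T.

Lemma linear_part_coordinates (R : realType) (phi : vehicle_position R) :
  linear_part (coordinates phi) = rotation phi.
Proof. by rewrite /linear_part row_mxKl mxvecK. Qed.

Lemma translation_part_coordinates (R : realType) (phi : vehicle_position R) :
  translation_part (coordinates phi) = translation phi.
Proof. by rewrite /translation_part row_mxKr trmxK. Qed.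

Lemma polymx_linear_part (R : realType) : polymx (@linear_part R).
Proof.
move=> i j; have := polyfun_coord (R := R) (lshift 2 (mxvec_index i j)).
by congr polyfun; apply/funext => x; rewrite !mxE.
Qed.

Lemma polymx_translation_part (R : realType) : polymx (@translation_part R).
Proof.
move=> i j; have := polyfun_coord (R := R) (rshift (2 * 2) i).
by congr polyfun; apply/funext => x; rewrite !mxE (ord1 j).
Qed.

Lemma vehicle_varietyE (R : realType) :
  @vehicle_variety R = [set x |
    (linear_part x)^T *m linear_part x = 1%:M /\ \det (linear_part x) = 1].
Proof.
apply/seteqP; split => x /=.
- by move=> [phi _ <-]; rewrite linear_part_coordinates; case: phi.
- move=> [h1 h2]; exists (VehiclePosition (translation_part x) h1 h2) => //.
  by rewrite /coordinates /= trmxK vec_mxK hsubmxK.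
Qed.

Lemma zariski_closed_vehicle_variety (R : realType) :
  zariski_closed (@vehicle_variety R).
Proof.
pose E (x : 'rV[R]_(2 * 2 + 2)) := (linear_part x)^T *m linear_part x - 1%:M.
have hE : polymx E.
  apply: polymxB; last exact: polymx_cst.
  by apply: polymxM; [apply: polymx_tr|]; apply: polymx_linear_part.
have hd := polyfunB (polyfun_det (@polymx_linear_part R)) (polyfun_cst 1).
have hG g : [set g | exists i j, g = fun x => E x i j] g -> polyfun g.
  by move=> [i [j ->]].
rewrite vehicle_varietyE.
have := zariski_closedI (zariski_closed_zeros hG) (zariski_closed_zero hd).
congr zariski_closed; apply/seteqP; split => x /=.
- move=> [/= hx /eqP]; rewrite subr_eq0 => /eqP; split => //.
  apply/eqP; rewrite -subr_eq0; apply/eqP/matrixP => i j; rewrite [RHS]mxE.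
  by apply: (hx (fun x => E x i j)); exists i, j.
- move=> [h1 h2]; split=> /=; last by rewrite h2 subrr.
  by move=> _ [i [j ->]]; rewrite /E h1 subrr mxE.
Qed.

Definition mx2 (S : Type) (a b c d : S) : 'M[S]_2 :=
  \matrix_(i, j) (if i == 0 then if j == 0 then a else b
                  else if j == 0 then c else d).

Lemma matrixP2 (S : Type) (A : 'M[S]_2) a b c d :
  A 0 0 = a -> A 0 1 = b -> A 1 0 = c -> A 1 1 = d -> A = mx2 a b c d.
Proof.
move=> h1 h2 h3 h4; apply/matrixP => i j; rewrite mxE.
by case: (ord2P i) (ord2P j) => -> [] ->.
Qed.

(* The rotation is given by the square of the complex number p + i q divided
   by its norm, so that all coordinates are rational functions of p, q, x, y
   with denominator p ^ 2 + q ^ 2. *)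
Definition vehicle_point (R : realType) (p q x y : R) : 'rV[R]_(2 * 2 + 2) :=
  let c := (p ^+ 2 - q ^+ 2) / (p ^+ 2 + q ^+ 2) in
  let s := 2 * p * q / (p ^+ 2 + q ^+ 2) in
  row_mx (mxvec (mx2 c (- s) s c)) (\row_i if i == 0 then x else y).

Lemma linear_part_vehicle_point (R : realType) (p q x y : R) :
  linear_part (vehicle_point p q x y) =
  (let c := (p ^+ 2 - q ^+ 2) / (p ^+ 2 + q ^+ 2) in
   let s := 2 * p * q / (p ^+ 2 + q ^+ 2) in mx2 c (- s) s c).
Proof. by rewrite /linear_part row_mxKl mxvecK. Qed.

Lemma vehicle_point_variety (R : realType) (p q x y : R) :
  p ^+ 2 + q ^+ 2 != 0 -> vehicle_variety (vehicle_point p q x y).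
Proof.
move=> n0; rewrite vehicle_varietyE /= linear_part_vehicle_point /=.
set c := (p ^+ 2 - q ^+ 2) / _; set s := 2 * p * q / _.
have cs : c * c + s * s = 1 by rewrite /c /s; field.
split; last by rewrite det_mx2 !mxE /=; lra.
rewrite [LHS](@matrixP2 _ _ 1 0 0 1) 1?[RHS](@matrixP2 _ _ 1 0 0 1) //;
  rewrite !mxE ?sum2E ?mxE //=; lra.
Qed.

Lemma special_orthogonal2 (R : realDomainType) (A : 'M[R]_2) :
  A^T *m A = 1%:M -> \det A = 1 ->
  [/\ A 1 1 = A 0 0, A 0 1 = - A 1 0 & A 0 0 ^+ 2 + A 1 0 ^+ 2 = 1].
Proof.
move=> ort; rewrite det_mx2.
have := congr1 (fun M : 'M_2 => M 0 0) ort.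
have := congr1 (fun M : 'M_2 => M 1 1) ort.
rewrite !mxE !sum2E !mxE /= => h11 h00 det1.
(* This sum of squares is the trace of [A^T *m A] minus twice the determinant, that is 2 - 2. *)
have : (A 1 1 - A 0 0) ^+ 2 + (A 0 1 + A 1 0) ^+ 2 = 0 by lra.
move/eqP; rewrite paddr_eq0 ?sqr_ge0 // !sqrf_eq0 subr_eq0 addr_eq0.
by move=> /andP[/eqP -> /eqP ->]; rewrite !expr2.
Qed.

Lemma vehicle_pointP (R : realType) (z : 'rV[R]_(2 * 2 + 2)) :
  vehicle_variety z ->
  exists p q x y, p ^+ 2 + q ^+ 2 = 1 /\ z = vehicle_point p q x y.
Proof.
rewrite vehicle_varietyE => -[/= ort det1].
set A := linear_part z in ort det1.
have [ad bc cs1] := special_orthogonal2 ort det1.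
suff [p [q [n1 [hc hs]]]] : exists p q : R, [/\ p ^+ 2 + q ^+ 2 = 1,
    p ^+ 2 - q ^+ 2 = A 0 0 & 2 * p * q = A 1 0].
  exists p, q, (translation_part z 0 0), (translation_part z 1 0); split => //.
  rewrite -[LHS]hsubmxK -[lsubmx z]vec_mxK -/(linear_part z) -/A.
  rewrite /vehicle_point n1 !divr1 hc hs; congr (row_mx (mxvec _) _).
    exact: matrixP2.
  apply/matrixP => k i; rewrite (ord1 k) [RHS]mxE.
  by case: (ord2P i) => ->; rewrite /translation_part [in RHS]mxE.
have [c1|c1] := eqVneq (1 + A 0 0) 0.
  exists 0, 1; have c1' : A 0 0 = -1 by lra.
  have /eqP : A 1 0 ^+ 2 = 0 by move: cs1; rewrite c1'; lra.
  by rewrite sqrf_eq0 => /eqP ->; rewrite c1'; split; ring.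
have c0 : 0 < (1 + A 0 0) / 2.
  have : 0 <= 1 + A 0 0 by move: (sqr_ge0 (A 1 0)); nra.
  by rewrite le_eqVlt eq_sym (negbTE c1) /= => ?; rewrite divr_gt0.
set p := Num.sqrt ((1 + A 0 0) / 2).
have p2 : p ^+ 2 = (1 + A 0 0) / 2 by rewrite sqr_sqrtr // ltW.
have p0 : p != 0 by rewrite lt0r_neq0 // sqrtr_gt0.
have q2 : (A 1 0 / (2 * p)) ^+ 2 = (1 - A 0 0) / 2.
  rewrite expr_div_n exprMn p2.
  have -> : A 1 0 ^+ 2 = (1 + A 0 0) * (1 - A 0 0) by lra.
  by field.
exists p, (A 1 0 / (2 * p)); rewrite q2 p2; split; [lra|lra|].
by field.
Qed.
(** A nonzero p has fewer than [size p] roots, so the [size p] distinct numbers 0, 1, 2, ... cannot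
    all be roots. *)
Lemma poly_exists_nonroot (R : realType) (p : {poly R}) :
  p != 0 -> exists x, p.[x] != 0.
Proof.
move=> p0; apply: contrapT => /forallNP h.
have := max_poly_roots p0 (rs := [seq i%:R | i <- iota 0 (size p)]).
rewrite size_map size_iota ltnn map_inj_uniq ?iota_uniq; last first.
  by move=> i j /eqP; rewrite eqr_nat => /eqP.
have -> : all (root p) [seq i%:R | i <- iota 0 (size p)].
  by apply/allP => x _; apply: contrapT => /negP; exact: h.
by move=> /(_ isT isT).
Qed.

(* S is a ring of functions on T, through the evaluation morphisms ev. *)
Lemma vehicle_point_pullback (R : realType) (S : comNzRingType) (T : Type)
    (ev : T -> {rmorphism S -> R}) (cst : R -> S)
    (ev_cst : forall t a, ev t (cst a) = a) (P Q X Y : S)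
    (f : 'rV[R]_(2 * 2 + 2) -> R) : polyfun f ->
  exists k G, forall t, ev t (P ^+ 2 + Q ^+ 2) != 0 ->
    f (vehicle_point (ev t P) (ev t Q) (ev t X) (ev t Y)) *
      ev t (P ^+ 2 + Q ^+ 2) ^+ k = ev t G.
Proof.
elim=> [a|i|{}f g _ [k [F hF]] _ [l [G hG]]|{}f g _ [k [F hF]] _ [l [G hG]]].
- by exists 0%N, (cst a) => t _; rewrite ev_cst expr0 mulr1.
- exists 1%N; have [j ->|j ->] := split_ordP i.
    case: (mxvec_indexP j) => r s.
    exists (mx2 (P ^+ 2 - Q ^+ 2) (- (2 * P * Q)) (2 * P * Q) (P ^+ 2 - Q ^+ 2)
      r s) => t n0; rewrite /vehicle_point row_mxEl mxvecE !mxE expr1.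
    move: n0; rewrite !(rmorphD, rmorphXn) => n0.
    by case: (ord2P r) (ord2P s) => -> [] -> /=;
      rewrite !(rmorphB, rmorphN, rmorphM, rmorphXn, rmorph_nat); field.
  (* The exponent 1 was fixed for all coordinates, so a translation coordinate carries the
     denominator as a factor. *)
  exists ((if j == 0 then X else Y) * (P ^+ 2 + Q ^+ 2)) => t n0.
  by rewrite /vehicle_point row_mxEr mxE expr1 rmorphM; case: ifP.
- exists (k + l)%N.
  exists (F * (P ^+ 2 + Q ^+ 2) ^+ l + G * (P ^+ 2 + Q ^+ 2) ^+ k) => t n0.
  move: (P ^+ 2 + Q ^+ 2) n0 hF hG => N n0 hF hG.
  rewrite rmorphD !rmorphM.
  by rewrite -(hF _ n0) -(hG _ n0) !rmorphXn exprD; ring.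
- exists (k + l)%N, (F * G) => t n0.
  move: (P ^+ 2 + Q ^+ 2) n0 hF hG => N n0 hF hG.
  by rewrite rmorphM -(hF _ n0) -(hG _ n0) exprD; ring.
Qed.

(* Any two points of the variety lie on a rational curve in it. *)
Lemma vehicle_variety_irreducible (R : realType) :
  zariski_irreducible (@vehicle_variety R).
Proof.
split.
  exists (vehicle_point 1 0 0 0); apply: vehicle_point_variety.
  by rewrite expr1n expr0n addr0 oner_neq0.
move=> Y1 Y2 c1 c2 Y12; apply: contrapT => /not_orP.
move=> [/existsNP[z1 /not_implyP[Vz1 Yz1]] /existsNP[z2 /not_implyP[Vz2 Yz2]]].
have [f1 [pf1 f1Y f1z]] := zariski_closed_separate c1 Yz1.
have [f2 [pf2 f2Y f2z]] := zariski_closed_separate c2 Yz2.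
have [p1 [q1 [x1 [y1 [n1 z1E]]]]] := vehicle_pointP Vz1.
have [p2 [q2 [x2 [y2 [n2 z2E]]]]] := vehicle_pointP Vz2.
have [seg seg01] : exists seg : R -> R -> {poly R}, forall a b,
    horner_eval 0 (seg a b) = a /\ horner_eval 1 (seg a b) = b.
  exists (fun a b => a%:P + (b - a) *: 'X) => a b.
  rewrite /horner_eval !(hornerD, hornerC, hornerZ, hornerX) mulr0 mulr1 addr0.
  by rewrite addrC subrK.
have seg0 a b := (seg01 a b).1; have seg1 a b := (seg01 a b).2.
have evc (t a : R) : horner_eval t a%:P = a by rewrite /horner_eval hornerC.
(* The four parameters are interpolated linearly from the first point at t = 0 to the second at t =
   1. *)
pose P := seg p1 p2; pose Q := seg q1 q2.
pose X := seg x1 x2; pose Y := seg y1 y2.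
have [k1 [G1 h1]] := vehicle_point_pullback evc P Q X Y pf1.
have [k2 [G2 h2]] := vehicle_point_pullback evc P Q X Y pf2.
pose N := P ^+ 2 + Q ^+ 2.
have N0 : horner_eval 0 N = 1 by rewrite rmorphD !rmorphXn /= /P /Q !seg0.
have N1 : horner_eval 1 N = 1 by rewrite rmorphD !rmorphXn /= /P /Q !seg1.
(* At such a t the curve is defined and neither f1 nor f2 vanishes, so its point lies in V but in
   neither Y1 nor Y2. *)
have [t] : exists t, (N * G1 * G2).[t] != 0.
  apply: poly_exists_nonroot; rewrite !mulf_neq0 //.
  - by apply/eqP => NE; move: N0; rewrite NE rmorph0 => /esym/eqP;
      rewrite oner_eq0.
  - apply/eqP => GE; move: (h1 0); rewrite GE rmorph0 /= -/N N0 expr1n mulr1.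
    by rewrite /P /Q /X /Y !seg0 -z1E => /(_ (oner_neq0 _))/eqP; rewrite (negbTE f1z).
  - apply/eqP => GE; move: (h2 1); rewrite GE rmorph0 /= -/N N1 expr1n mulr1.
    by rewrite /P /Q /X /Y !seg1 -z2E => /(_ (oner_neq0 _))/eqP; rewrite (negbTE f2z).
rewrite !hornerM !mulf_eq0 !negb_or => /andP[/andP[Nt]].
rewrite -[G1.[t]]/(horner_eval t G1) -[G2.[t]]/(horner_eval t G2).
rewrite -(h1 _ Nt) -(h2 _ Nt) !mulf_eq0 !negb_or => /andP[F1 _] /andP[F2 _].
have /Y12 : vehicle_variety (vehicle_point (horner_eval t P) (horner_eval t Q)
    (horner_eval t X) (horner_eval t Y)).
  by apply: vehicle_point_variety; move: Nt;
     rewrite -[N.[t]]/(horner_eval t N) rmorphD !rmorphXn.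
by move=> [/f1Y/eqP|/f2Y/eqP]; [rewrite (negbTE F1)|rewrite (negbTE F2)].
Qed.
(** * Dimension *)

Definition lin_indep (R : realType) (n : nat) (T : finType)
    (g : T -> 'rV[R]_n -> R) (X : set 'rV[R]_n) :=
  forall a : T -> R, (forall x, X x -> \sum_t a t * g t x = 0) ->
  forall t, a t = 0.

(** In a relation on X', the lowest power of f can be cancelled because X' is irreducible.
    Restricting to X, where f vanishes, leaves a relation among the [g t] alone. *)
Lemma lin_indep_powers (R : realType) (n M : nat) (T : finType)
    (g : T -> 'rV[R]_n -> R) (f : 'rV[R]_n -> R) (X X' : set 'rV[R]_n) :
  (forall t, polyfun (g t)) -> polyfun f -> zariski_irreducible X' ->
  X `<=` X' -> (forall x, X x -> f x = 0) -> (exists2 x, X' x & f x != 0) ->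
  lin_indep g X ->
  lin_indep (fun (tj : T * 'I_M) x => g tj.1 x * f x ^+ tj.2) X'.
Proof.
move=> pg pf irr XX' fX [x0 X'x0 fx0] ind a h.
pose G (j : 'I_M) x := \sum_t a (t, j) * g t x.
have pG j : polyfun (G j).
  by apply: polyfun_sum => t; apply: polyfunM => //; exact: polyfun_cst.
have hG x : X' x -> \sum_(j < M) f x ^+ j * G j x = 0.
  move=> X'x; rewrite -[RHS](h _ X'x).
  rewrite [RHS](eq_bigr (fun p => a (p.1, p.2) * (g p.1 x * f x ^+ p.2)));
    last by case.
  rewrite -(pair_bigA _ (fun t (j : 'I_M) => a (t, j) * (g t x * f x ^+ j))).
  rewrite exchange_big /=; apply: eq_bigr => j _.
  by rewrite /G mulr_sumr; apply: eq_bigr => t _; ring.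
suff aj j : forall t, a (t, j) = 0 by case.
have [k] := ubnP (j : nat); elim: k j => // k IH j /ltnSE jk.
have G0 (i : 'I_M) x : (i < j)%N -> G i x = 0.
  move=> ij; rewrite /G big1 // => t _.
  by rewrite IH ?mul0r //; apply: leq_trans jk.
pose H x := \sum_(i < M | (j <= i)%N) f x ^+ (i - j) * G i x.
have H0 : forall x, X' x -> H x = 0.
  apply: (irreducible_polyfunM irr (f := fun x => f x ^+ j)).
  - exact: polyfunX.
  - by apply: polyfun_sum => i; apply: polyfunM => //; apply: polyfunX.
  - move=> x /hG <-; rewrite mulr_sumr big_mkcond; apply: eq_bigr => i _.
    case: leqP => [ji|ij]; last by rewrite G0 ?mulr0.
    by rewrite mulrA -exprD subnKC.
  - by exists x0 => //; rewrite expf_neq0.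
(* On X only the term i = j of H survives, with f to the power 0. *)
apply: (ind (fun t => a (t, j))) => x Xx.
move: (H0 x (XX' _ Xx)); rewrite /H (bigD1 j) //= subnn expr0 mul1r.
rewrite big1 ?addr0 // => i /andP[ji nij]; rewrite fX // expr0n subn_eq0.
by rewrite leqNgt ltn_neqAle ji eq_sym nij mul0r.
Qed.

(** Exponent vectors as nested pairs, so that each step up a chain adds one factor, as in
    [lin_indep_powers]. *)
Fixpoint exponents (M r : nat) : finType :=
  if r is r'.+1 then (exponents M r' * 'I_M)%type else unit.

Fixpoint monomial (T : Type) (S : pzSemiRingType) (M : nat) (f : nat -> T -> S)
    (r : nat) : exponents M r -> T -> S :=
  if r is r'.+1 then fun t x => monomial f t.1 x * f r' x ^+ t.2
  else fun _ _ => 1.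

Lemma card_exponents M r : #|exponents M r| = (M ^ r)%N.
Proof.
by elim: r => [|r IH]; rewrite ?card_unit //= card_prod IH card_ord expnSr.
Qed.

Lemma polyfun_monomial (R : realType) (n M : nat) (f : nat -> 'rV[R]_n -> R) r
    (t : exponents M r) :
  (forall i, (i < r)%N -> polyfun (f i)) -> polyfun (monomial f t).
Proof.
elim: r t => [|r IH] t pf /=; first exact: polyfun_cst.
by apply: polyfunM; [apply: IH => i ir; apply/pf/ltnW|apply/polyfunX/pf].
Qed.

Lemma lin_indep_monomials (R : realType) (n M r : nat)
    (f : nat -> 'rV[R]_n -> R) (X : nat -> set 'rV[R]_n) :
  (forall i, (i <= r)%N -> zariski_irreducible (X i)) ->
  (forall i, (i < r)%N -> X i `<=` X i.+1) ->
  (forall i, (i < r)%N -> [/\ polyfun (f i), forall x, X i x -> f i x = 0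
     & exists2 x, X i.+1 x & f i x != 0]) ->
  lin_indep (@monomial _ _ M f r) (X r).
Proof.
elim: r => [|r IH] irr XS hf.
  (* The only monomial is the constant 1, which is independent because [X 0] is nonempty. *)
  move=> a h []; have [[x X0x] _] := irr _ (leqnn _).
  have := h _ X0x; rewrite (bigD1 tt) //= mulr1 big1 ?addr0 //.
have [pf f0 f1] := hf r (ltnSn r).
apply: (lin_indep_powers (g := @monomial _ _ M f r)) pf _ _ f0 f1 _ => //.
- by move=> t; apply: polyfun_monomial => i ir; have [] := hf _ (ltnW ir).
- exact: irr.
- exact: XS.
- by apply: IH => i ir; [apply: irr; rewrite ltnW|apply: XS; rewrite ltnW|
    apply: hf; rewrite ltnW].
Qed.

Lemma chain_separating_functions (R : realType) (n k : nat) (Y : set 'rV[R]_n)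
    (X : nat -> set 'rV[R]_n) : irreducible_chain Y k X ->
  exists f : nat -> 'rV[R]_n -> R, forall i, (i < k)%N ->
    [/\ polyfun (f i), forall x, X i x -> f i x = 0
      & exists2 x, X i.+1 x & f i x != 0].
Proof.
move=> [hX XS].
suff /choice[f hf] : forall i, exists fi : 'rV[R]_n -> R, (i < k)%N ->
    [/\ polyfun fi, forall x, X i x -> fi x = 0
      & exists2 x, X i.+1 x & fi x != 0] by exists f.
move=> i; have [ik|_] := boolP (i < k)%N; last by exists (fun=> 0).
have [_ /nonsubset[x [Xx Xix]]] := XS i ik.
have [ci _ _] := hX i (ltnW ik).
have [fi [pf f0 f1]] := zariski_closed_separate ci Xix.
by exists fi => _; split => //; exists x.
Qed.

(** * Degree bounds and linear dependence of polynomials *)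

(** [mmeasure mdeg] is the degree plus one, and 0 for the zero polynomial; a bound [a.+1] thus means
    degree at most a. *)
Lemma msizeM_leq (R : idomainType) n a b (p q : mpoly n R) :
  (mmeasure mdeg p <= a.+1)%N -> (mmeasure mdeg q <= b.+1)%N ->
  (mmeasure mdeg (p * q) <= (a + b).+1)%N.
Proof.
have [-> _ _|p0] := eqVneq p 0; first by rewrite mul0r msize0.
have [-> _ _|q0] := eqVneq q 0; first by rewrite mulr0 msize0.
rewrite msizeM // => ha hb; move: ha.
have : (0 < mmeasure mdeg p)%N by rewrite lt0n msize_poly_eq0.
case: (mmeasure mdeg p) => // c _.
by rewrite addSn /= ltnS => ca; rewrite -addnS leq_add.
Qed.

Lemma msizeX_leq (R : idomainType) n a k (p : mpoly n R) :
  (mmeasure mdeg p <= a.+1)%N -> (mmeasure mdeg (p ^+ k) <= (k * a).+1)%N.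
Proof.
move=> ha; elim: k => [|k IH]; first by rewrite expr0 msize1.
by rewrite exprS mulSn; apply: msizeM_leq.
Qed.

(** Degree less than D forces every exponent below D, leaving at most D ^ n monomials. The
    coefficient matrix then has more rows than columns, hence a nonzero left kernel. *)
Lemma mpoly_dependent (R : fieldType) (n D : nat) (I : finType)
    (Q : I -> mpoly n R) :
  (forall i, (mmeasure mdeg (Q i) <= D)%N) -> (D ^ n < #|I|)%N ->
  exists a : I -> R, (exists i, a i != 0) /\ \sum_i a i *: Q i = 0.
Proof.
move=> hQ card.
pose J := {ffun 'I_n -> 'I_D}.
pose m (b : J) := Multinom [tuple (b j : nat) | j < n].
pose A : 'M[R]_(#|I|, #|J|) :=
  \matrix_(i, j) mcoeff (m (enum_val j)) (Q (enum_val i)).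
have : kermx A != 0.
  rewrite -mxrank_eq0 mxrank_ker subn_eq0 -ltnNge.
  apply: leq_ltn_trans (rank_leq_col A) _.
  by rewrite card_ffun !card_ord.
case/rowV0Pn => u /sub_kermxP uA u0.
exists (fun i => u 0 (enum_rank i)); split.
  have /rV0Pn[j uj] := u0.
  by exists (enum_val j); rewrite enum_valK.
apply/mpolyP => c; rewrite mcoeff0 raddf_sum /=.
have [cD|cD] := ltnP (mdeg c) D; last first.
  rewrite big1 // => i _; rewrite mcoeffZ memN_msupp_eq0 ?mulr0 //.
  by apply: msize_mdeg_ge; apply: leq_trans cD.
have cj (j : 'I_n) : (c j < D)%N.
  by apply: leq_ltn_trans cD; rewrite mdegE (bigD1 j) //= leq_addr.
have -> : c = m [ffun j => Ordinal (cj j)].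
  by apply/mnmP => j; rewrite mnmE ffunE.
have := congr1 (fun w : 'rV_#|J| =>
  w 0 (enum_rank [ffun j => Ordinal (cj j)])) uA.
rewrite !mxE => uA0.
rewrite -[RHS]uA0 (reindex_onto enum_rank enum_val) /=; last first.
  by move=> i _; rewrite enum_valK.
apply: eq_big => [i|i _]; first by rewrite enum_rankK eqxx.
by rewrite mcoeffZ mxE !enum_rankK.
Qed.
(** Each factor f ^ j has j < M, and multiplied by N ^ M it becomes G ^ j N ^ (M - j), of degree at
    most M e. All monomials thus share the denominator N ^ (r M). *)
Lemma monomial_clear_denominator (R : idomainType) (n : nat) (T : Type)
    (ev : T -> {rmorphism mpoly n R -> R}) (N : mpoly n R) (e M r : nat)
    (f : nat -> T -> R) (G : nat -> mpoly n R) (t : exponents M r) :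
  (mmeasure mdeg N <= e.+1)%N ->
  (forall i, (i < r)%N -> (mmeasure mdeg (G i) <= e.+1)%N) ->
  (forall i u, (i < r)%N -> f i u * ev u N = ev u (G i)) ->
  exists2 Q, (mmeasure mdeg Q <= (r * (M * e)).+1)%N &
    forall u, monomial f t u * ev u N ^+ (r * M) = ev u Q.
Proof.
elim: r t => [|r IH] t hN hG hf.
  by exists 1; rewrite ?msize1 // => u; rewrite /= mul1r rmorph1.
have [||Q hQ QE] := IH t.1 hN; first by move=> i ir; apply/hG/ltnW.
  by move=> i u ir; apply/hf/ltnW.
have tM := ltnW (ltn_ord t.2).
exists (G r ^+ t.2 * N ^+ (M - t.2) * Q).
  rewrite mulSn; apply: msizeM_leq => //.
  rewrite -[in (M * e)%N](subnKC tM) mulnDl.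
  by apply: msizeM_leq; apply: msizeX_leq => //; apply: hG.
move=> u /=; rewrite !rmorphM -QE !rmorphXn -hf // mulSn.
have -> : (M + r * M = t.2 + (M - t.2) + r * M)%N by rewrite subnKC.
by rewrite !exprD exprMn; ring.
Qed.

Lemma monomial_comp (T U : Type) (S : pzSemiRingType) M (f : nat -> T -> S)
    (h : U -> T) r (t : exponents M r) u :
  monomial (fun i u => f i (h u)) t u = monomial f t (h u).
Proof. by elim: r t => //= r IH t; rewrite IH. Qed.

Lemma vehicle_point_scale (R : realType) (p q x y : R) :
  p ^+ 2 + q ^+ 2 != 0 -> q != 0 ->
  vehicle_point p q x y = vehicle_point (p / q) 1 x y.
Proof.
move=> n0 q0; rewrite /vehicle_point.
have -> : ((p / q) ^+ 2 - 1 ^+ 2) / ((p / q) ^+ 2 + 1 ^+ 2) =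
  (p ^+ 2 - q ^+ 2) / (p ^+ 2 + q ^+ 2) by field; rewrite n0 q0.
by have -> : 2 * (p / q) * 1 / ((p / q) ^+ 2 + 1 ^+ 2) =
  2 * p * q / (p ^+ 2 + q ^+ 2) by field; rewrite n0 q0.
Qed.

(* The points missed by the chart q = 1 lie in a proper closed subset. *)
Lemma vehicle_variety_chart (R : realType) (g : 'rV[R]_(2 * 2 + 2) -> R) :
  polyfun g -> (forall p x y, g (vehicle_point p 1 x y) = 0) ->
  forall z, vehicle_variety z -> g z = 0.
Proof.
move=> pg g0.
(* One minus the cosine is 2 q ^ 2 / (p ^ 2 + q ^ 2); it vanishes where q = 0, so its product with g
   vanishes on all of V. *)
have pc := polyfunB (polyfun_cst 1) (@polymx_linear_part R 0 0).
apply: (irreducible_polyfunM (@vehicle_variety_irreducible R) pc pg).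
- move=> z /vehicle_pointP[p [q [x [y [n1 ->]]]]].
  have [q0|q0] := eqVneq q 0; last first.
    by rewrite vehicle_point_scale ?n1 ?oner_neq0 // g0 mulr0.
  rewrite linear_part_vehicle_point mxE /= n1.
  by move: n1; rewrite q0 expr0n addr0 subr0 => ->; rewrite divr1 subrr mul0r.
- exists (vehicle_point 0 1 0 0).
    by apply: vehicle_point_variety; rewrite expr0n expr1n add0r oner_neq0.
  rewrite linear_part_vehicle_point mxE /= expr0n expr1n /= !add0r divr1 opprK.
  by rewrite -(natrD _ 1 1) pnatr_eq0.
Qed.

Lemma vehicle_variety_dependent (R : realType)
    (f : nat -> 'rV[R]_(2 * 2 + 2) -> R) :
  (forall i, (i < 4)%N -> polyfun (f i)) ->
  exists M, ~ lin_indep (@monomial _ _ M f 4) (@vehicle_variety R).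
Proof.
move=> pf.
pose ev (u : 'I_3 -> R) : {rmorphism mpoly 3 R -> R} := meval u.
pose X i : mpoly 3 R := mpolyX R (mnm1 i).
have evC u a : ev u (mpolyC 3 a) = a by exact: mevalC.
pose N : mpoly 3 R := X 0 ^+ 2 + 1 ^+ 2.
have evN u : ev u N = u 0 ^+ 2 + 1.
  by rewrite rmorphD !rmorphXn rmorph1 expr1n /= mevalXU.
have evN0 u : ev u N != 0.
  by rewrite evN lt0r_neq0 // ltr_wpDl ?sqr_ge0.
pose pt u :=
  vehicle_point (ev u (X 0)) (ev u 1) (ev u (X 1)) (ev u (X ord_max)).
have /choice[kG hkG] : forall i, exists kG : nat * mpoly 3 R, (i < 4)%N ->
    forall u, f i (pt u) * ev u N ^+ kG.1 = ev u kG.2.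
  move=> i; have [/pf fi|_] := boolP (i < 4)%N; last by exists (0%N, 0).
  have [k [G hG]] := vehicle_point_pullback evC (X 0) 1 (X 1) (X ord_max) fi.
  by exists (k, G) => _ u; apply: hG; exact: evN0.
(* A common exponent, so that all four functions have the denominator N ^ K. *)
pose K := (\sum_(i < 4) (kG i).1)%N.
have kK i : (i < 4)%N -> ((kG i).1 <= K)%N.
  by move=> i4; rewrite /K (bigD1 (Ordinal i4)) //= leq_addr.
pose G i := (kG i).2 * N ^+ (K - (kG i).1).
have hG i u : (i < 4)%N -> f i (pt u) * ev u (N ^+ K) = ev u (G i).
  move=> i4; rewrite rmorphM -(hkG i i4) !rmorphXn.
  by rewrite -[in LHS](subnKC (kK _ i4)) exprD mulrA.
pose e := (mmeasure mdeg (N ^+ K) + \sum_(i < 4) mmeasure mdeg (G i))%N.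
have Ne : (mmeasure mdeg (N ^+ K) <= e.+1)%N by rewrite leqW // leq_addr.
have Ge i : (i < 4)%N -> (mmeasure mdeg (G i) <= e.+1)%N.
  move=> i4; apply: leqW; apply: leq_trans (leq_addl _ _).
  by rewrite (bigD1 (Ordinal i4)) //= leq_addr.
(* Chosen so that (4 M e + 1) ^ 3 <= M ^ 3 (4 e + 1) ^ 3 < M ^ 4. *)
pose M := ((4 * e).+1 ^ 3).+1.
have /choice[Q hQ] : forall t : exponents M 4, exists Q,
    (mmeasure mdeg Q <= (4 * (M * e)).+1)%N /\
    forall u, monomial f t (pt u) * ev u (N ^+ K) ^+ (4 * M) = ev u Q.
  move=> t; have [Q Q1 Q2] := monomial_clear_denominator t Ne Ge hG.
  by exists Q; split => // u; rewrite -Q2 monomial_comp.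
have card : ((4 * (M * e)).+1 ^ 3 < #|exponents M 4|)%N.
  rewrite card_exponents; apply: (@leq_ltn_trans ((M * (4 * e).+1) ^ 3)%N).
    by rewrite leq_exp2r // mulnS mulnCA -addn1 addnC leq_add2r.
  by rewrite expnMn [in X in (_ < X)%N]expnSr ltn_pmul2l ?expn_gt0.
have [a [[t at0] aQ]] := mpoly_dependent (fun t => (hQ t).1) card.
exists M => ind; move: at0; rewrite (ind a) ?eqxx //.
apply: vehicle_variety_chart.
  by apply: polyfun_sum => s; apply: polyfunM;
     [exact: polyfun_cst|exact: polyfun_monomial].
move=> p x y.
pose u (i : 'I_3) : R := if i == 0 then p else if i == 1 then x else y.
have -> : vehicle_point p 1 x y = pt u.
  by rewrite /pt rmorph1 /= !mevalXU.
have N0 : ev u (N ^+ K) ^+ (4 * M) != 0 by rewrite rmorphXn !expf_neq0.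
apply: (mulIf N0); rewrite mul0r mulr_suml -[RHS](rmorph0 (ev u)) -aQ rmorph_sum.
by apply: eq_bigr => s _; rewrite -mulrA (hQ s).2 -mevalZ.
Qed.

Lemma vehicle_variety_chain (R : realType) k X :
  irreducible_chain (@vehicle_variety R) k X -> (k < 4)%N.
Proof.
move=> chainX; rewrite ltnNge; apply/negP => k4.
have [hX XS] := chainX.
have [f hf] := chain_separating_functions chainX.
have [|M] := @vehicle_variety_dependent R f.
  by move=> i i4; have [] := hf i (leq_trans i4 k4).
(* A relation on V restricts to one on [X 4], where the monomials are independent. *)
apply => a h; apply: (lin_indep_monomials (X := X)) => [i i4|i i4|i i4|x X4x].
- by have [] := hX i (leq_trans i4 k4).
- by have [] := XS i (leq_trans i4 k4).
- exact/hf/(leq_trans i4).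
- by apply: h; have [_ _] := hX 4 k4; apply.
Qed.

Lemma dimension_proper_subset (R : realType) (Y : set 'rV[R]_(2 * 2 + 2)) :
  Y `<=` @vehicle_variety R -> ~ @vehicle_variety R `<=` Y ->
  (dimension Y < 3%:E)%E.
Proof.
move=> YV VY; apply: (@le_lt_trans _ _ 2%:E); last by rewrite lte_fin ltr_nat.
apply: ge_ereal_sup => _ [k [X [hX XS]] <-]; rewrite lee_fin ler_nat leqNgt.
apply/negP => k3.
(* The members 0 to 3 of the chain are kept and V is put on top as member 4. *)
pose X' i := if (i < 4)%N then X i else @vehicle_variety R.
suff /vehicle_variety_chain : irreducible_chain (@vehicle_variety R) 4 X' by [].
have XiY i : (i < 4)%N -> X i `<=` Y.
  by move=> i4; have [] := hX i (leq_trans (ltnSE i4) k3).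
split => i; rewrite /X'.
- move=> _; case: ifP => i4; last first.
    by split=> //; [exact: zariski_closed_vehicle_variety|
      exact: vehicle_variety_irreducible].
  have [ci ii _] := hX i (leq_trans (ltnSE i4) k3).
  by split => //; apply: subset_trans YV; apply: XiY.
- move=> i4; rewrite i4 ltnS; case: ifP => i3.
    by apply: XS; apply: leq_trans k3.
  by split; [apply: subset_trans YV; apply: XiY|
    move=> VX; apply: VY; apply: subset_trans VX _; apply: XiY].
Qed.

(** * Thin sets of positions *)

(** Smallness witnessed by a single polynomial: unions correspond to products, which stay nonzero on
    V by irreducibility. *)
Definition thin (R : realType) (B : set 'rV[R]_(2 * 2 + 2)) :=
  exists f, [/\ polyfun f, exists2 z, vehicle_variety z & f z != 0
    & forall z, B z -> f z = 0].

Lemma thin0 (R : realType) : thin (@set0 'rV[R]_(2 * 2 + 2)).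
Proof.
exists (fun=> 1); split => //; first exact: polyfun_cst.
have [[z Vz] _] := @vehicle_variety_irreducible R.
by exists z; rewrite ?oner_neq0.
Qed.

Lemma thinU (R : realType) (A B : set 'rV[R]_(2 * 2 + 2)) :
  thin A -> thin B -> thin (A `|` B).
Proof.
move=> [f [pf f0 fA]] [g [pg [z Vz gz] gB]].
exists (fun z => f z * g z); split; first exact: polyfunM.
- apply: contrapT => h; move: gz; apply/negP; rewrite negbK; apply/eqP.
  apply: (irreducible_polyfunM (@vehicle_variety_irreducible R) pf pg) Vz => //.
  by move=> y Vy; apply: contrapT => /eqP fg; apply: h; exists y.
- by move=> y [/fA ->|/gB ->]; rewrite ?mul0r ?mulr0.
Qed.

Lemma thin_bigcup (R : realType) (T : finType)
    (B : T -> set 'rV[R]_(2 * 2 + 2)) :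
  (forall t, thin (B t)) -> thin (\bigcup_t B t).
Proof.
move=> hB; suff : forall s : seq T, thin [set z | exists2 t, t \in s & B t z].
  move=> /(_ (enum T)); congr thin; apply/seteqP; split => z /=.
    by move=> [t _ Bt]; exists t.
  by move=> [t _ Bt]; exists t; rewrite ?mem_enum.
elim=> [|t s IH].
  move: (@thin0 R); congr thin; apply/seteqP; split => z //=.
  by move=> [t]; rewrite in_nil.
move: (thinU (hB t) IH); congr thin; apply/seteqP; split => z /=.
- by move=> [Bt|[t' st' Bt']]; [exists t|exists t'];
    rewrite ?inE ?eqxx ?st' ?orbT.
- by move=> [t']; rewrite inE => /orP[/eqP ->|st'] Bt'; [left|right; exists t'].
Qed.

Lemma thin_sub_closed (R : realType) (B : set 'rV[R]_(2 * 2 + 2)) :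
  B `<=` @vehicle_variety R -> thin B ->
  exists Y, [/\ zariski_closed Y, Y `<=` @vehicle_variety R,
    (dimension Y < 3%:E)%E & B `<=` Y].
Proof.
move=> BV [f [pf [z Vz fz] fB]].
exists (@vehicle_variety R `&` [set z | f z = 0]).
have YV := @subIsetl _ (@vehicle_variety R) [set z | f z = 0].
split => //.
- apply: zariski_closedI; last exact: zariski_closed_zero.
  exact: zariski_closed_vehicle_variety.
- by apply: dimension_proper_subset => // /(_ _ Vz)[_ /eqP]; rewrite (negbTE fz).
- by move=> y By; split; [exact: BV|exact: fB].
Qed.

(** * Trilateration *)

(** The quadratic form of the adjugate of the Gram matrix with rows (u, v) and (v, w), evaluated at
    (x, y). *)
Definition gram_form (R : pzRingType) (u v w x y : R) :=
  x ^+ 2 * w - 2 * x * y * v + y ^+ 2 * u.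

(** Comparison of the coefficients of t ^ 4, and of t ^ 2 once the quartic part is gone. They are
    extracted by the fourth and second central differences, which yield 24 and 2 times the
    coefficient. *)
Lemma gram_form_pencil (R : realType) (u v w D A0 B0 C0 A1 B1 C1 A2 B2 C2 : R) :
  (forall t, gram_form u v w (A1 * t ^+ 2 + B1 * t + C1)
     (A2 * t ^+ 2 + B2 * t + C2) = 4 * (A0 * t ^+ 2 + B0 * t + C0) * D) ->
  gram_form u v w A1 A2 = 0 /\
  (A1 = 0 -> A2 = 0 -> gram_form u v w B1 B2 = 4 * A0 * D).
Proof.
move=> h; pose P t := gram_form u v w (A1 * t ^+ 2 + B1 * t + C1)
  (A2 * t ^+ 2 + B2 * t + C2) - 4 * (A0 * t ^+ 2 + B0 * t + C0) * D.
have P0 t : P t = 0 by rewrite /P h subrr.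
split.
- have /mulfI inj24 : (24 : R) != 0 by rewrite pnatr_eq0.
  apply: inj24; rewrite mulr0.
  transitivity (P 2 - 4 * P 1 + 6 * P 0 - 4 * P (-1) + P (-2)).
    by rewrite /P /gram_form; ring.
  by rewrite !P0; ring.
- move=> A10 A20; have /mulfI inj2 : (2 : R) != 0 by rewrite pnatr_eq0.
  apply/eqP; rewrite -subr_eq0; apply/eqP/inj2; rewrite mulr0.
  transitivity (P 1 - 2 * P 0 + P (-1)).
    by rewrite /P /gram_form A10 A20; ring.
  by rewrite !P0; ring.
Qed.

Definition cross (R : pzRingType) (a b : 'cV[R]_2) :=
  a 0 0 * b 1 0 - a 1 0 * b 0 0.

(** The form equals |x e2 - y e1| ^ 2, and e1, e2 are linearly independent. *)
Lemma gram_form_eq0 (R : realType) (e1 e2 : 'cV[R]_2) x y :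
  cross e1 e2 != 0 ->
  gram_form (dot e1 e1) (dot e1 e2) (dot e2 e2) x y = 0 -> x = 0 /\ y = 0.
Proof.
rewrite /gram_form !dotE /cross => D0.
have -> : forall a b c d : R,
    x ^+ 2 * (c * c + d * d) - 2 * x * y * (a * c + b * d) +
    y ^+ 2 * (a * a + b * b) = (x * c - y * a) ^+ 2 + (x * d - y * b) ^+ 2.
  by move=> a b c d; ring.
move/eqP; rewrite paddr_eq0 ?sqr_ge0 // !sqrf_eq0 => /andP[/eqP h1 /eqP h2].
split; apply: (mulIf D0); rewrite mul0r.
- transitivity (e1 0 0 * (x * e2 1 0 - y * e1 1 0) -
    e1 1 0 * (x * e2 0 0 - y * e1 0 0)); first by ring.
  by rewrite h1 h2; ring.
- transitivity (e2 0 0 * (x * e2 1 0 - y * e1 1 0) -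
    e2 1 0 * (x * e2 0 0 - y * e1 0 0)); first by ring.
  by rewrite h1 h2; ring.
Qed.

Lemma gram_form_dot (R : realType) (e1 e2 b : 'cV[R]_2) :
  gram_form (dot e1 e1) (dot e1 e2) (dot e2 e2) (dot b e1) (dot b e2) =
  dot b b * cross e1 e2 ^+ 2.
Proof. by rewrite /gram_form /cross !dotE; ring. Qed.

(* With s the point at squared distance d i from m i and e j = m j - m 0, the
   numbers d 0 - d j + |e j|^2 are 2 (s - m 0 | e j); the Gram matrix of the e j
   then expresses |s - m 0|^2 = d 0 as the vanishing of this polynomial. *)
Definition trilateration_defect (R : realType) (m : 'I_3 -> 'cV[R]_2)
    (d : 'I_3 -> R) :=
  let e1 := m 1 - m 0 in let e2 := m ord_max - m 0 in
  gram_form (dot e1 e1) (dot e1 e2) (dot e2 e2)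
    (d 0 - d 1 + dot e1 e1) (d 0 - d ord_max + dot e2 e2)
  - 4 * d 0 * cross e1 e2 ^+ 2.

Lemma trilateration_defect_eq0 (R : realType) (m : 'I_3 -> 'cV[R]_2) d s :
  (forall i, sqdist s (m i) = d i) -> trilateration_defect m d = 0.
Proof.
move=> hs; rewrite /trilateration_defect -!hs /gram_form /cross /sqdist !dotE.
rewrite !mxE; ring.
Qed.

Lemma polyfun_trilateration_defect (R : realType) n
    (m : 'I_3 -> 'rV[R]_n -> 'cV[R]_2) (d : 'I_3 -> 'rV[R]_n -> R) :
  (forall i, polymx (m i)) -> (forall i, polyfun (d i)) ->
  polyfun (fun x => trilateration_defect (m^~ x) (d^~ x)).
Proof.
move=> hm hd; rewrite /trilateration_defect /gram_form /cross.
repeat (first [ exact: polyfun_cst | exact: hd | exact: hm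
  | apply: polyfunB | apply: polyfunD | apply: polyfunX | apply: polyfun_dot
  | apply: polymxB | apply: polyfunM ]).
Qed.

(** Differences of squared distances are affine in the point, so x - y is orthogonal to two
    independent vectors. *)
Lemma trilateration_unique (R : realType) (m : 'I_3 -> 'cV[R]_2) x y :
  cross (m 1 - m 0) (m ord_max - m 0) != 0 ->
  (forall i, sqdist x (m i) = sqdist y (m i)) -> x = y.
Proof.
move=> D0 h; set e1 := m 1 - m 0; set e2 := m ord_max - m 0.
have dot0 k : dot (x - y) (m k - m 0) = 0.
  have /mulfI inj2 : (2 : R) != 0 by rewrite pnatr_eq0.
  apply: inj2; rewrite mulr0.
  transitivity (sqdist y (m k) - sqdist x (m k) + sqdist x (m 0)
    - sqdist y (m 0)); first by rewrite /sqdist !dotE !mxE; ring.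
  by rewrite !h; ring.
have d1 : dot (x - y) e1 = 0 := dot0 1.
have d2 : dot (x - y) e2 = 0 := dot0 ord_max.
have xy0 : x - y = 0.
  apply: colP2; rewrite [RHS]mxE; apply: (mulIf D0); rewrite mul0r -/e1 -/e2.
  - transitivity (dot (x - y) e1 * e2 1 0 - dot (x - y) e2 * e1 1 0).
      by rewrite /cross !dotE; ring.
    by rewrite d1 d2; ring.
  - transitivity (dot (x - y) e2 * e1 0 0 - dot (x - y) e1 * e2 0 0).
      by rewrite /cross !dotE; ring.
    by rewrite d1 d2; ring.
by apply/eqP; rewrite -subr_eq0 xy0.
Qed.

Lemma det_mulmx_lt (F : fieldType) n k (A : 'M[F]_(n, k)) (B : 'M[F]_(k, n)) :
  (k < n)%N -> \det (A *m B) = 0.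
Proof.
move=> kn; apply: contrapT => /eqP; rewrite -unitfE -unitmxE => /mxrank_unit r.
by move: (mulmx_max_rank A B); rewrite r leqNgt kn.
Qed.

(* The Cayley-Menger matrix of points in the plane is the Gram matrix of the
   vectors (|p|^2, 1, p) and (1, 0, 0) for a bilinear form on a space of
   dimension 4. *)
Lemma f_D_sqdist (R : realType) (m : 'I_3 -> 'cV[R]_2) s :
  f_D (\matrix_(i, j) sqdist (m i) (m j)) (\row_i sqdist s (m i)) = 0.
Proof.
pose u (p : 'cV[R]_2) : 'rV[R]_(2 + 2) :=
  row_mx (\row_k if k == 0 then dot p p else 1) p^T.
pose v (p : 'cV[R]_2) : 'cV[R]_(2 + 2) :=
  col_mx (\col_k if k == 0 then 1 else dot p p) (-2 *: p).
pose ue : 'rV[R]_(2 + 2) := row_mx (\row_k if k == 0 then 1 else 0) 0.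
pose ve : 'cV[R]_(2 + 2) := col_mx (\col_k if k == 0 then 0 else 1) 0.
have uv p q : u p *m v q = (sqdist p q)%:M.
  apply/matrixP => i j; rewrite (ord1 i) (ord1 j) mul_row_col.
  rewrite !mxE !sum2E !mxE /=.
  by rewrite /sqdist !dotE !mxE mulr1n; ring.
have uev q : ue *m v q = 1%:M.
  apply/matrixP => i j; rewrite (ord1 i) (ord1 j) mul_row_col.
  rewrite !mxE !sum2E !mxE /=.
  by rewrite mulr1n; ring.
have uve p : u p *m ve = 1%:M.
  apply/matrixP => i j; rewrite (ord1 i) (ord1 j) mul_row_col.
  rewrite !mxE !sum2E !mxE /=.
  by rewrite mulr1n; ring.
have ueve : ue *m ve = 0.
  apply/matrixP => i j; rewrite (ord1 i) (ord1 j) mul_row_col.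
  rewrite !mxE !sum2E !mxE /=.
  by ring.
pose um : 'M[R]_(3, 2 + 2) := \matrix_(i, k) u (m i) 0 k.
pose vm : 'M[R]_(2 + 2, 3) := \matrix_(k, j) v (m j) k 0.
have row_um i : row i um = u (m i) by apply/rowP => k; rewrite !mxE.
have col_vm j : col j vm = v (m j) by apply/colP => k; rewrite !mxE.
have mulE k l n (A : 'M[R]_(k, n)) (B : 'M[R]_(n, l)) i j :
    (A *m B) i j = (row i A *m col j B) 0 0.
  by rewrite !mxE; apply: eq_bigr => c _; rewrite !mxE.
have rowcol (w : 'rV[R]_(2 + 2)) i : row i w = w.
  by apply/rowP => k; rewrite mxE (ord1 i).
have colrow (w : 'cV[R]_(2 + 2)) i : col i w = w.
  by apply/colP => k; rewrite mxE (ord1 i).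
rewrite /f_D (_ : block_mx _ _ _ _ =
  col_mx (u s) (col_mx um ue) *m row_mx (v s) (row_mx vm ve)).
  exact: det_mulmx_lt.
rewrite mul_col_row mul_mx_row mul_col_mx mul_col_row uv uev uve ueve.
have sqxx p : sqdist p p = 0 by rewrite /sqdist subrr dotE !mxE !mul0r addr0.
have sqC p q : sqdist p q = sqdist q p by rewrite /sqdist !dotE !mxE; ring.
congr block_mx.
- by rewrite sqxx; apply/matrixP => i j; rewrite !mxE mul0rn.
- congr row_mx; apply/matrixP => i j; last by rewrite !mxE (ord1 i) (ord1 j).
  by rewrite (ord1 i) mulE rowcol col_vm uv !mxE.
- congr col_mx; apply/matrixP => i j; last by rewrite !mxE (ord1 i) (ord1 j).
  by rewrite (ord1 j) mulE row_um colrow uv sqC !mxE.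
- congr block_mx; apply/matrixP => i j.
  + by rewrite mulE row_um col_vm uv !mxE.
  + by rewrite (ord1 j) mulE row_um colrow uve !mxE.
  + by rewrite (ord1 i) mulE rowcol col_vm uev !mxE.
Qed.
(** * Mirror points *)

Lemma dot_eq0 (R : realType) (x : 'cV[R]_2) : dot x x = 0 -> x = 0.
Proof.
rewrite dotE -!expr2 => /eqP; rewrite paddr_eq0 ?sqr_ge0 // !sqrf_eq0.
by move=> /andP[/eqP h0 /eqP h1]; apply: colP2; rewrite mxE.
Qed.

(** Hesse normal form: n is the direction of the line turned by a right angle and normalised, h the
    offset. It shows that the reflection is polynomial in x. *)
Lemma ref_normal_form (R : realType) (W : set 'cV[R]_2) :
  is_line W -> exists n h, dot n n = 1 /\
    forall x, ref W x = x - (2 * (dot x n - h)) *: n.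
Proof.
move=> [p [v [v0 ->]]].
have vv : v 0 0 * v 0 0 + v 1 0 * v 1 0 != 0.
  by apply: contra v0; rewrite -dotE => /eqP/dot_eq0 ->.
have vvp : 0 < v 0 0 * v 0 0 + v 1 0 * v 1 0.
  by rewrite lt_def vv -!expr2 addr_ge0 ?sqr_ge0.
pose k := (Num.sqrt (v 0 0 * v 0 0 + v 1 0 * v 1 0))^-1.
have k2 : k ^+ 2 = (v 0 0 * v 0 0 + v 1 0 * v 1 0)^-1.
  by rewrite exprVn sqr_sqrtr // ltW.
pose n : 'cV[R]_2 := k *: \col_i (if i == 0 then - v 1 0 else v 0 0).
exists n, (dot p n); split.
  rewrite dotE !mxE /=.
  transitivity (k ^+ 2 * (v 0 0 * v 0 0 + v 1 0 * v 1 0)); first by ring.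
  by rewrite k2 mulVf.
move=> x; rewrite refE //; apply: colP2; rewrite !dotE !mxE /=.
- transitivity (x 0 0 - 2 * k ^+ 2 * ((x 1 0 - p 1 0) * v 0 0 -
    (x 0 0 - p 0 0) * v 1 0) * - v 1 0); last by ring.
  by rewrite k2; field.
- transitivity (x 1 0 - 2 * k ^+ 2 * ((x 1 0 - p 1 0) * v 0 0 -
    (x 0 0 - p 0 0) * v 1 0) * v 0 0); last by ring.
  by rewrite k2; field.
Qed.

Lemma polymx_ref (R : realType) n (W : set 'cV[R]_2) (F : 'rV[R]_n -> 'cV[R]_2) :
  is_line W -> polymx F -> polymx (fun x => ref W (F x)).
Proof.
move=> /ref_normal_form[v [h [_ refW]]] hF.
under eq_fun do rewrite refW.
apply: polymxB => //; apply: polymxZ; last exact: polymx_cst.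
apply: polyfunM; first exact: polyfun_cst.
by apply: polyfunB; [apply: polyfun_dot => //; exact: polymx_cst|
  exact: polyfun_cst].
Qed.

(** Reflecting x changes the squared distance by four times the product of the signed distances of x
    and y from the line. *)
Lemma sqdist_reflection (R : realType) (n x y : 'cV[R]_2) h : dot n n = 1 ->
  sqdist (x - (2 * (dot x n - h)) *: n) y =
  sqdist x y + 4 * (dot x n - h) * (dot y n - h).
Proof.
move=> n1; apply/eqP; rewrite -subr_eq0; apply/eqP.
transitivity (4 * (dot x n - h) ^+ 2 * (dot n n - 1)); last first.
  by rewrite n1 subrr mulr0.
by rewrite /sqdist !dotE !mxE; ring.
Qed.

(** * Walls whose defect vanishes at all positions *)

Lemma gram_form_parallelogram (R : comPzRingType) (u v w x y x' y' : R) :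
  gram_form u v w (x + x') (y + y') + gram_form u v w (x - x') (y - y') =
  2 * (gram_form u v w x y + gram_form u v w x' y').
Proof. by rewrite /gram_form; ring. Qed.

(** The microphones are translated along b after a rotation by 0 or pi. The sign eps leaves inner
    products and [cross] unchanged, so [gram_form_pencil] applies to the defect as a polynomial in
    t. *)
Lemma trilateration_pencil (R : realType) (E : 'I_3 -> 'cV[R]_2) (b : 'cV[R]_2)
    (eps : R) (a2 a1 a0 : 'I_3 -> R) :
  E 0 = 0 -> eps ^+ 2 = 1 ->
  (forall t, trilateration_defect (fun i => t *: b + eps *: E i)
     (fun i => a2 i * t ^+ 2 + a1 i * t + a0 i) = 0) ->
  let G := gram_form (dot (E 1) (E 1)) (dot (E 1) (E ord_max))
    (dot (E ord_max) (E ord_max)) in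
  G (a2 0 - a2 1) (a2 0 - a2 ord_max) = 0 /\
  (a2 0 = a2 1 -> a2 0 = a2 ord_max ->
   G (a1 0 - a1 1) (a1 0 - a1 ord_max) =
   4 * a2 0 * cross (E 1) (E ord_max) ^+ 2).
Proof.
move=> E0 eps2 h G.
have [t|h1 h2] := @gram_form_pencil R (dot (E 1) (E 1)) (dot (E 1) (E ord_max))
  (dot (E ord_max) (E ord_max)) (cross (E 1) (E ord_max) ^+ 2)
  (a2 0) (a1 0) (a0 0)
  (a2 0 - a2 1) (a1 0 - a1 1) (a0 0 - a0 1 + dot (E 1) (E 1))
  (a2 0 - a2 ord_max) (a1 0 - a1 ord_max)
  (a0 0 - a0 ord_max + dot (E ord_max) (E ord_max)); last first.
  by split => // h01 h02; apply: h2; rewrite -?h01 -?h02 subrr.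
apply/eqP; rewrite -subr_eq0; apply/eqP; rewrite -[RHS](h t).
rewrite /trilateration_defect E0 scaler0 addr0.
have addK (x y : 'cV[R]_2) : x + y - x = y by rewrite addrC addKr.
rewrite !addK.
have dotZ (x y : 'cV[R]_2) : dot (eps *: x) (eps *: y) = dot x y.
  by rewrite -[RHS]mul1r -eps2 !dotE !mxE; ring.
have crossZ (x y : 'cV[R]_2) : cross (eps *: x) (eps *: y) = cross x y.
  by rewrite -[RHS]mul1r -eps2 /cross !mxE; ring.
rewrite !dotZ crossZ; congr (gram_form _ _ _ _ _ - _); by ring.
Qed.

(* Adding the relations for the rotations by 0 and by pi isolates the
   contribution of the walls. *)
Lemma gram_form_even_part (R : realType) (e1 e2 b : 'cV[R]_2) (x y : R) :
  cross e1 e2 != 0 ->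
  (forall eps, eps ^+ 2 = 1 ->
    gram_form (dot e1 e1) (dot e1 e2) (dot e2 e2)
      (x + eps * dot b e1) (y + eps * dot b e2) = dot b b * cross e1 e2 ^+ 2) ->
  x = 0 /\ y = 0.
Proof.
move=> D0 h; apply: (gram_form_eq0 D0).
have := gram_form_parallelogram (dot e1 e1) (dot e1 e2) (dot e2 e2) x y
  (dot b e1) (dot b e2).
have := h 1 (expr1n _ _); have := h (-1) (etrans (sqrrN 1) (expr1n _ _)).
rewrite !mul1r !mulN1r gram_form_dot => -> ->.
lra.
Qed.

(** In dimension 2 minus the identity has determinant 1: it is the rotation by pi. *)
Lemma rotation_by_sign (R : realType) (eps : R) (b : 'cV[R]_2) :
  eps ^+ 2 = 1 -> exists phi, forall x, move phi x = eps *: x + b.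
Proof.
move=> eps2.
have h1 : (eps%:M : 'M[R]_2)^T *m eps%:M = 1%:M.
  by rewrite tr_scalar_mx -scalar_mxM -expr2 eps2.
have h2 : \det (eps%:M : 'M[R]_2) = 1 by rewrite det_scalar.
by exists (VehiclePosition b h1 h2) => x; rewrite /move mul_scalar_mx.
Qed.

(** Along t b all squared distances have the same leading coefficient |b| ^ 2, so the coefficient of
    t ^ 2 in the defect gives a relation for each sign. Their even part makes s 0 - s i orthogonal
    to every b. *)
Lemma fixed_mirror_points_eq (R : realType) (mini s : 'I_3 -> 'cV[R]_2) :
  cross (mini 1 - mini 0) (mini ord_max - mini 0) != 0 ->
  (forall phi, trilateration_defect (fun i => move phi (mini i))
     (fun i => sqdist (s i) (move phi (mini i))) = 0) ->
  forall i, s i = s 0.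
Proof.
move=> D0 h; pose E i := mini i - mini 0.
have hb (b : 'cV[R]_2) : dot b (s 0 - s 1) = 0 /\ dot b (s 0 - s ord_max) = 0.
  apply: (gram_form_even_part (b := b) D0) => eps eps2.
  have [t|_] := @trilateration_pencil R E b eps (fun=> dot b b)
    (fun i => -2 * dot b (s i - eps *: E i))
    (fun i => dot (s i - eps *: E i) (s i - eps *: E i)) (subrr _) eps2.
    (* This translation brings microphone 0 to t b and microphone i to t b + eps E i. *)
    have [phi phiE] := rotation_by_sign (t *: b - eps *: mini 0) eps2.
    rewrite -[RHS](h phi); congr trilateration_defect; apply/funext => i.
      by rewrite phiE /E scalerBr addrCA.
    by rewrite phiE /sqdist /E !dotE !mxE; ring.
  move=> /(_ erefl erefl) G.
  have /mulfI inj4 : (4 : R) != 0 by rewrite pnatr_eq0.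
  apply: inj4; rewrite mulrA -G /gram_form /E !dotE !mxE; ring.
have s_eq i : (forall b, dot b (s 0 - s i) = 0) -> s i = s 0.
  by move=> /(_ (s 0 - s i))/dot_eq0/eqP; rewrite subr_eq0 => /eqP ->.
by move=> i; case: (ord3P i) => -> //; apply: s_eq => b; have [] := hb b.
Qed.

(** At b = m the hypothesis is the equality case of Cauchy-Schwarz; the sign is [dot m n]. *)
Lemma unit_vectors_eq_sign (R : realType) (m n : 'cV[R]_2) :
  dot m m = 1 -> dot n n = 1 ->
  (forall b, dot b m ^+ 2 = dot b n ^+ 2) ->
  exists2 sg, sg ^+ 2 = 1 & n = sg *: m.
Proof.
move=> m1 n1 /(_ m); rewrite m1 expr1n => /esym mn.
exists (dot m n) => //; apply/eqP; rewrite -subr_eq0; apply/eqP/dot_eq0.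
transitivity (dot n n - 2 * dot m n ^+ 2 + dot m n ^+ 2 * dot m m).
  by rewrite !dotE !mxE; ring.
by rewrite n1 m1 mn; ring.
Qed.

(** The coefficient of t ^ 4 shows that the unit normals agree up to sign; then the coefficient of t
    ^ 2 along the common normal shows that the offsets agree up to the same signs. So the
    reflections coincide. *)
Lemma mounted_reflections_eq (R : realType) (mini : 'I_3 -> 'cV[R]_2)
    (lini : 'cV[R]_2) (W : 'I_3 -> set 'cV[R]_2) :
  (forall i, is_line (W i)) ->
  cross (mini 1 - mini 0) (mini ord_max - mini 0) != 0 ->
  (forall phi, trilateration_defect (fun i => move phi (mini i))
     (fun i => sqdist (ref (W i) (move phi lini)) (move phi (mini i))) = 0) ->
  forall i x, ref (W i) x = ref (W 0) x.
Proof.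
move=> Wline D0 h; pose E i := mini i - mini 0; pose la := lini - mini 0.
have /choice[n /choice[c hW]] := fun i => ref_normal_form (Wline i).
have n1 i : dot (n i) (n i) = 1 by have [] := hW i.
(* Coefficients in t of the squared distances, from [sqdist_reflection] with loudspeaker t b + eps
   la and microphone t b + eps E i. *)
pose a2 b i := 4 * dot b (n i) ^+ 2.
pose a1 b eps i := 4 * dot b (n i) *
  (eps * dot la (n i) + eps * dot (E i) (n i) - 2 * c i).
pose a0 eps i := sqdist la (E i) +
  4 * (eps * dot la (n i) - c i) * (eps * dot (E i) (n i) - c i).
have pencil b eps : eps ^+ 2 = 1 ->
    forall t, trilateration_defect (fun i => t *: b + eps *: E i)
     (fun i => a2 b i * t ^+ 2 + a1 b eps i * t + a0 eps i) = 0.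
  move=> eps2 t.
  have [phi phiE] := rotation_by_sign (t *: b - eps *: mini 0) eps2.
  rewrite -[RHS](h phi); congr trilateration_defect; apply/funext => i.
    by rewrite phiE /E scalerBr addrCA.
  have [_ ->] := hW i; rewrite sqdist_reflection ?n1 // !phiE.
  have -> : sqdist (eps *: lini + (t *: b - eps *: mini 0))
    (eps *: mini i + (t *: b - eps *: mini 0)) = sqdist la (E i).
    by rewrite -[RHS]mul1r -eps2 /sqdist !dotE !mxE; ring.
  by rewrite /a2 /a1 /a0 /la /E !dotE !mxE; ring.
have a2E b : a2 b 0 = a2 b 1 /\ a2 b 0 = a2 b ord_max.
  have [G _] :=
    trilateration_pencil (subrr _) (expr1n _ _) (pencil b 1 (expr1n _ _)).
  have [] := gram_form_eq0 D0 G.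
  by split; apply/eqP; rewrite -subr_eq0; apply/eqP.
have sgn i : exists2 sg, sg ^+ 2 = 1 & n i = sg *: n 0.
  apply: unit_vectors_eq_sign => // b.
  have /mulfI inj4 : (4 : R) != 0 by rewrite pnatr_eq0.
  by apply: inj4; have [] := a2E b; case: (ord3P i) => ->.
have {sgn} /choice[sg hsg] : forall i, exists sg, sg ^+ 2 = 1 /\ n i = sg *: n 0.
  by move=> i; have [s] := sgn i; exists s.
have dot_n i b : dot b (n i) = sg i * dot b (n 0).
  by rewrite (hsg i).2 !dotE !mxE; ring.
have sg1 i : sg i * sg i = 1 by rewrite -expr2 (hsg i).1.
have n0n0 : dot (- n 0) (- n 0) = 1 by rewrite -(n1 0) !dotE !mxE; ring.
have a2n0 i : a2 (n 0) i = 4 by rewrite /a2 dot_n n1 mulr1 (hsg i).1 mulr1.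
have a1n0 eps i : a1 (n 0) eps i = 4 * (eps * dot la (n 0) +
    eps * dot (E i) (n 0) - 2 * (sg i * c i)).
  rewrite /a1 !(dot_n i) n1; have := sg1 i.
  move: (dot la _) (dot (E i) _) (sg i) (c i) => x y s d ss.
  transitivity (4 * (s * s * (eps * x + eps * y) - 2 * (s * d))); first by ring.
  by rewrite ss mul1r.
have E0 : dot (E 0) (n 0) = 0 by rewrite /E subrr dotE !mxE; ring.
have [c1 c2] : 2 * (sg 1 * c 1 - sg 0 * c 0) = 0 /\
    2 * (sg ord_max * c ord_max - sg 0 * c 0) = 0.
  (* In the differences of the a1, E i enters with a minus sign, whence - n 0. *)
  apply: (gram_form_even_part (b := - n 0) D0) => eps eps2.
  have [_] := trilateration_pencil (subrr _) eps2 (pencil (n 0) eps eps2).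
  rewrite !a2n0 !a1n0 E0 => /(_ erefl erefl) G.
  have /mulfI inj16 : (16 : R) != 0 by rewrite pnatr_eq0.
  apply: inj16; rewrite n0n0 mul1r.
  transitivity (4 * 4 * cross (E 1) (E ord_max) ^+ 2); last by ring.
  by rewrite -G /gram_form /E !dotE !mxE; ring.
have sgc i : sg i * c i = sg 0 * c 0.
  have /mulfI inj2 : (2 : R) != 0 by rewrite pnatr_eq0.
  apply/eqP; rewrite -subr_eq0; apply/eqP/inj2; rewrite mulr0.
  by case: (ord3P i) => -> //; rewrite subrr mulr0.
have refE' i x : ref (W i) x = x - (2 * (dot x (n 0) - sg i * c i)) *: n 0.
  have [_ ->] := hW i; rewrite dot_n (hsg i).2 scalerA; congr (_ - _ *: _).
  have := sg1 i; move: (dot x _) (sg i) (c i) => y s d ss.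
  transitivity (2 * (s * s * y - s * d)); first by ring.
  by rewrite ss mul1r.
by move=> i x; rewrite !refE' sgc.
Qed.
(** * Detection *)

Lemma noncollinear_cross (R : realType) (m : 'I_3 -> 'cV[R]_2) :
  ~ (exists W, is_line W /\ forall i, W (m i)) ->
  cross (m 1 - m 0) (m ord_max - m 0) != 0.
Proof.
move=> nocol; apply/eqP => c0; apply: nocol.
set e1 := m 1 - m 0 in c0; set e2 := m ord_max - m 0 in c0.
have on_line v t i : m i - m 0 = t *: v -> line (m 0) v (m i).
  by move=> h; exists t => //; rewrite -h addrC subrK.
have [e10|e10] := eqVneq e1 0.
  (* If all three points coincide, any nonzero direction serves. *)
  pose v := if e2 == 0 then const_mx 1 else e2.
  have v0 : v != 0.
    rewrite /v; have [//|//] := eqVneq e2 0; move=> _.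
    apply/eqP => /(congr1 (fun w : 'cV_2 => w 0 0))/eqP.
    by rewrite !mxE oner_eq0.
  exists (line (m 0) v); split; first by exists (m 0), v.
  move=> i; case: (ord3P i) => ->.
  - by apply: (on_line _ 0); rewrite subrr scale0r.
  - by apply: (on_line _ 0); rewrite scale0r.
  - rewrite /v; have [e20|_] := eqVneq e2 0.
      by apply: (on_line _ 0); rewrite scale0r.
    by apply: (on_line _ 1); rewrite scale1r.
exists (line (m 0) e1); split; first by exists (m 0), e1.
have d0 : dot e1 e1 != 0 by apply: contra e10 => /eqP/dot_eq0 ->.
move=> i; case: (ord3P i) => ->.
- by apply: (on_line _ 0); rewrite subrr scale0r.
- by apply: (on_line _ 1); rewrite scale1r.
(* The coefficient of the orthogonal projection of e2 to e1. *)
- apply: (on_line _ (dot e1 e2 / dot e1 e1)); rewrite -/e2.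
  apply/eqP; rewrite -subr_eq0; apply/eqP.
  apply: (scalerI d0); rewrite scaler0 scalerBr scalerA mulrCA divff // mulr1.
  apply: colP2; rewrite !dotE !mxE.
  + by rewrite -[RHS](mulr0 (- e1 1 0)) -c0 /cross !mxE; ring.
  + by rewrite -[RHS](mulr0 (e1 0 0)) -c0 /cross !mxE; ring.
Qed.

Lemma cross_move (R : realType) (phi : vehicle_position R) (x y z : 'cV[R]_2) :
  cross (move phi y - move phi x) (move phi z - move phi x) =
  cross (y - x) (z - x).
Proof.
rewrite -[RHS]mul1r -(rotation_det phi) det_mx2 /move /cross !mxE !sum2E.
ring.
Qed.

(** Extends [move] from positions to a polynomial map on all of R^6. *)
Definition move_at (R : realType) (v : 'cV[R]_2) (z : 'rV[R]_(2 * 2 + 2)) :=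
  linear_part z *m v + translation_part z.

Lemma move_at_coordinates (R : realType) (v : 'cV[R]_2) phi :
  move_at v (coordinates phi) = move phi v.
Proof.
by rewrite /move_at linear_part_coordinates translation_part_coordinates.
Qed.

Lemma polymx_move_at (R : realType) (v : 'cV[R]_2) : polymx (move_at v).
Proof.
apply: polymxD; last exact: polymx_translation_part.
by apply: polymxM; [exact: polymx_linear_part|exact: polymx_cst].
Qed.

Definition loudspeaker_at (R : realType) (l : loudspeaker R)
    (z : 'rV[R]_(2 * 2 + 2)) :=
  match l with Fixed L => L | Mounted Lini => move_at Lini z end.

Lemma loudspeaker_at_coordinates (R : realType) (l : loudspeaker R) phi :
  loudspeaker_at l (coordinates phi) = loudspeaker_position l phi.
Proof. by case: l => //= L; exact: move_at_coordinates. Qed.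

Lemma polymx_loudspeaker_at (R : realType) (l : loudspeaker R) :
  polymx (loudspeaker_at l).
Proof. by case: l => L /=; [exact: polymx_cst|exact: polymx_move_at]. Qed.

Definition wall_defect (R : realType) (mini : 'I_3 -> 'cV[R]_2)
    (l : loudspeaker R) (W : 'I_3 -> set 'cV[R]_2) (z : 'rV[R]_(2 * 2 + 2)) :=
  trilateration_defect (fun i => move_at (mini i) z)
    (fun i => sqdist (ref (W i) (loudspeaker_at l z)) (move_at (mini i) z)).

Lemma wall_defectE (R : realType) (mini : 'I_3 -> 'cV[R]_2) l W phi :
  wall_defect mini l W (coordinates phi) =
  trilateration_defect (fun i => move phi (mini i))
    (fun i => sqdist (ref (W i) (loudspeaker_position l phi))
       (move phi (mini i))).
Proof.
rewrite /wall_defect loudspeaker_at_coordinates.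
by congr trilateration_defect; apply/funext => i; rewrite move_at_coordinates.
Qed.

Lemma polyfun_wall_defect (R : realType) (mini : 'I_3 -> 'cV[R]_2) l W :
  (forall i, is_line (W i)) -> polyfun (wall_defect mini l W).
Proof.
move=> Wline; apply: (polyfun_trilateration_defect
  (m := fun i => move_at (mini i))
  (d := fun i z => sqdist (ref (W i) (loudspeaker_at l z)) (move_at (mini i) z))).
  by move=> i; exact: polymx_move_at.
move=> i; apply: polyfun_sqdist; last exact: polymx_move_at.
by apply: polymx_ref => //; exact: polymx_loudspeaker_at.
Qed.

Lemma wall_defect_eq0 (R : realType) (mini : 'I_3 -> 'cV[R]_2) l W :
  (forall i, is_line (W i)) ->
  cross (mini 1 - mini 0) (mini ord_max - mini 0) != 0 ->
  (forall phi, wall_defect mini l W (coordinates phi) = 0) ->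
  forall phi i, ref (W i) (loudspeaker_position l phi) =
    ref (W 0) (loudspeaker_position l phi).
Proof.
move=> Wline D0 h phi i; case: l h => L h /=.
- apply: (fixed_mirror_points_eq (s := fun i => ref (W i) L) D0) => psi.
  by rewrite -[RHS](h psi) wall_defectE.
- apply: (mounted_reflections_eq (lini := L) Wline D0) => psi.
  by rewrite -[RHS](h psi) wall_defectE.
Qed.

(** The distances of the wall's own mirror point pass the test at every position, so only ghosts can
    make a position bad. *)
Lemma heard_by_all_detected (R : realType) (mini : 'I_3 -> 'cV[R]_2) l heard
    phi W :
  cross (mini 1 - mini 0) (mini ord_max - mini 0) != 0 ->
  (forall i, heard i phi W) -> detected mini l heard phi W.
Proof.
move=> D0 hW; pose s := ref W (loudspeaker_position l phi).
exists (\row_i sqdist s (move phi (mini i))); split.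
- by move=> i; exists W => //; rewrite mxE.
- exact: f_D_sqdist.
- split=> [i|y hy]; first by rewrite mxE.
  apply: (trilateration_unique (m := fun i => move phi (mini i))).
    by rewrite cross_move.
  by move=> i; rewrite hy mxE.
Qed.

Theorem theorem4p1 (R : realType)
  (walls : set (set 'cV[R]_2))
  (walls_finite : finite_set walls)
  (walls_lines : forall W, walls W -> is_line W)
  (mini : 'I_3 -> 'cV[R]_2)
  (mini_noncollinear : ~ exists W, is_line W /\ forall i, W (mini i))
  (l : loudspeaker R)
  (heard : 'I_3 -> vehicle_position R -> set (set 'cV[R]_2))
  (heard_walls : forall i phi, heard i phi `<=` walls) :
  exists Y : set 'rV[R]_(2 * 2 + 2),
    [/\ zariski_closed Y,
        Y `<=` @vehicle_variety R,
        (dimension Y < 3%:E)%E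
      & [set coordinates phi | phi in
          [set phi | ~ good_position walls mini l heard phi]] `<=` Y].
Proof.
have D0 := noncollinear_cross mini_noncollinear.
apply: thin_sub_closed; first by move=> _ [phi _ <-]; exists phi.
have [ws wsE] : exists ws : seq (set 'cV[R]_2), walls = [set` ws].
  exact/finite_seqP.
(* Triples of walls are indexed by a finite type, as the finite union of thin sets requires. *)
pose wall (k : {ffun 'I_3 -> 'I_(size ws)}) i := nth set0 ws (k i).
have wall_line k i : is_line (wall k i).
  by apply: walls_lines; rewrite wsE /= mem_nth.
pose nontrivial k :=
  exists phi, wall_defect mini l (wall k) (coordinates phi) != 0.
(* Triples whose defect vanishes at all positions contribute the empty set; their mirror points
   always agree. *)
pose B k := [set z | nontrivial k /\ wall_defect mini l (wall k) z = 0].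
have thinB k : thin (B k).
  have [[phi nt]|tr] := pselect (nontrivial k).
    exists (wall_defect mini l (wall k)); split.
    - exact: polyfun_wall_defect.
    - by exists (coordinates phi) => //; exists phi.
    - by move=> z [].
  by move: (@thin0 R); congr thin; apply/seteqP; split => z // [].
have [f [pf f0 fB]] := thin_bigcup thinB.
exists f; split => // _ [phi bad <-]; apply: fB; apply: contrapT => nB.
apply: bad; split; first by move=> W; exact: heard_by_all_detected.
move=> s [[d [hd _ [sd sU]]] ghost_s]; apply: ghost_s.
have /choice[W hW] : forall i, exists W, heard i phi W /\
    sqdist (ref W (loudspeaker_position l phi)) (move phi (mini i)) = d 0 i.
  by move=> i; have [W] := hd i; exists W.
have Wws i : (index (W i) ws < size ws)%N.
  by rewrite index_mem; have := heard_walls _ _ _ (hW i).1; rewrite wsE.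
pose k : {ffun 'I_3 -> 'I_(size ws)} := [ffun i => Ordinal (Wws i)].
have wallk : wall k = W.
  by apply/funext => i; rewrite /wall ffunE /= nth_index // -index_mem.
have defect0 : wall_defect mini l (wall k) (coordinates phi) = 0.
  rewrite wall_defectE; apply: (trilateration_defect_eq0 (s := s)) => i.
  by rewrite wallk sd (hW i).2.
have trivial_k psi : wall_defect mini l (wall k) (coordinates psi) = 0.
  apply: contrapT => /eqP nt; apply: nB; exists k => //.
  by split => //; exists psi.
have W_eq := wall_defect_eq0 (wall_line k) D0 trivial_k phi.
rewrite wallk in W_eq.
(* The common mirror point has all three distances d, so by uniqueness it is s. *)
exists (W 0); first exact: heard_walls (hW 0).1.
by apply: sU => i; rewrite -(W_eq i) (hW i).2.
Qed.
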